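(* Let $(M,\omega,\mathcal{F},\mathcal{G})$ be a bi-Lagrangian manifold of dimension $2n$ with bi-Lagrangian connection $\nabla$, and let $(x,y)=(x_1,\ldots,x_n,y_1,\ldots,y_n)$ be a local coordinate system, centered at a point of $M$, in which $T\mathcal{F}=\bigcap_{i=1}^n\ker dy_i$ and $T\mathcal{G}=\bigcap_{i=1}^n\ker dx_i$. Let $A$ be the $n\times n$ matrix with entries $A_{ij}=\omega\big(\frac{\partial}{\partial x_i},\frac{\partial}{\partial y_j}\big)$. Then $\nabla$ is flat (near the center of the coordinate system) if and only if there exist smooth matrix-valued function-germs $f,g:(\mathbb{R}^n,0)\to M_{n\times n}(\mathbb{R})$ which satisfy $$A(x,y)=f(x)\cdot g(y)$$ as germs at $0$.
   Context: A bi-Lagrangian manifold $(M,\omega,\mathcal{F},\mathcal{G})$ consists of a symplectic manifold $(M,\omega)$ and two foliations $\mathcal{F},\mathcal{G}$ of $M$ whose leaves are Lagrangian submanifolds and intersect transversely at each point. Its bi-Lagrangian connection is the unique affine connection $\nabla$ such that: $\nabla\omega=0$; $\nabla_v\Gamma(T\mathcal{F})\subseteq T\mathcal{F}$ and $\nabla_v\Gamma(T\mathcal{G})\subseteq T\mathcal{G}$ for each $v\in TM$; and $\nabla_XY-\nabla_YX=[X,Y]$ for $X\in\Gamma(T\mathcal{F})$, $Y\in\Gamma(T\mathcal{G})$. Flat means that the curvature tensor vanishes identically. *)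

(* Defs.v *)
From HB Require Import structures.
From mathcomp Require Import all_boot all_order all_algebra.
From mathcomp Require Import all_classical all_reals all_analysis.

Set Implicit Arguments.
Unset Strict Implicit.
Unset Printing Implicit Defensive.

Import Order.TTheory GRing.Theory Num.Theory.
Import numFieldNormedType.Exports.
Local Open Scope classical_set_scope.
Local Open Scope ring_scope.

(* [kdiff k U f]: all iterated partial derivatives of f of order < k exist and
   are differentiable on U.  Differentiability at every order makes all these
   derivatives continuous, so that [smooth U f] is C^infinity on an open U. *)
Fixpoint kdiff (R : realType) (m : nat) (W : normedModType R) (k : nat)
    (U : set 'rV[R]_m) (f : 'rV[R]_m -> W) : Prop :=
  if k is k'.+1 then
    (forall u, U u -> differentiable f u) /\
    (forall i : 'I_m, kdiff k' U (fun u => 'D_(delta_mx 0 i) f u))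
  else True.

Definition smooth (R : realType) (m : nat) (W : normedModType R)
    (U : set 'rV[R]_m) (f : 'rV[R]_m -> W) : Prop :=
  forall k, kdiff k U f.

(* [chart_map] is only meaningful on [chart_dom], and [chart_inv] on the image of [chart_dom]. *)
Record chart (R : realType) (m : nat) (M : topologicalType) := Chart {
  chart_dom : set M;
  chart_map : M -> 'rV[R]_m;
  chart_inv : 'rV[R]_m -> M }.

Definition is_chart (R : realType) (m : nat) (M : topologicalType)
    (c : chart R m M) : Prop :=
  [/\ open (chart_dom c),
      open (chart_map c @` chart_dom c),
      (forall p, chart_dom c p -> chart_inv c (chart_map c p) = p),
      (forall p, chart_dom c p -> {for p, continuous (chart_map c)}) &
      (forall p, chart_dom c p -> {for chart_map c p, continuous (chart_inv c)})].

Definition transition (R : realType) (m : nat) (M : topologicalType)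
    (c d : chart R m M) : 'rV[R]_m -> 'rV[R]_m := chart_map d \o chart_inv c.

Definition compatible (R : realType) (m : nat) (M : topologicalType)
    (c d : chart R m M) : Prop :=
  smooth (chart_map c @` (chart_dom c `&` chart_dom d)) (transition c d).

(* Smooth m-dimensional manifold; [atlas] is the maximal atlas. *)
Record manifold (R : realType) (m : nat) := Manifold {
  carrier :> topologicalType;
  atlas : set (chart R m carrier);
  carrier_hausdorff : hausdorff_space carrier;
  carrier_second_countable : @second_countable carrier;
  atlas_chart : forall c, atlas c -> is_chart c;
  atlas_cover : forall p, exists2 c, atlas c & chart_dom c p;
  atlas_compatible : forall c d, atlas c -> atlas d -> compatible c d;
  atlas_maximal : forall c, is_chart c ->
    (forall d, atlas d -> compatible c d /\ compatible d c) -> atlas c }.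

Definition chart_at (R : realType) (m : nat) (M : manifold R m) (p : M)
    (c : chart R m M) : Prop := atlas c /\ chart_dom c p.

(* A tangent vector at p is the family of its components in all the charts at
   p, two such components being related by the differential of the transition
   map.  Components at the other charts are set to 0, so that [=] is equality of
   tangent vectors, and vectors are added and scaled as functions. *)
Definition tvec (R : realType) (m : nat) (M : manifold R m) :=
  chart R m M -> 'rV[R]_m.

Definition TM (R : realType) (m : nat) (M : manifold R m) (p : M) :
    set (tvec M) :=
  [set v | (forall c, ~ chart_at p c -> v c = 0) /\
           (forall c d, chart_at p c -> chart_at p d ->
              v d = 'd (transition c d) (chart_map c p) (v c))].

(* The tangent vector at p with components w in the chart c at p. *)
Definition tvec_of (R : realType) (m : nat) (M : manifold R m)
    (c : chart R m M) (p : M) (w : 'rV[R]_m) : tvec M :=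
  fun d => if `[< chart_at p d >] then 'd (transition c d) (chart_map c p) w else 0.

(* d/du_k and du_k, for the coordinates u_0, ..., u_(m-1) of the chart c. *)
Definition coord_field (R : realType) (m : nat) (M : manifold R m)
    (c : chart R m M) (k : 'I_m) (p : M) : tvec M :=
  tvec_of c p (delta_mx 0 k).

Definition dcoord (R : realType) (m : nat) (M : manifold R m)
    (c : chart R m M) (k : 'I_m) (v : tvec M) : R := v c 0 k.

Definition smooth_fun (R : realType) (m : nat) (M : manifold R m)
    (W : set M) (h : M -> R) : Prop :=
  forall c, atlas c -> smooth (chart_map c @` (W `&` chart_dom c)) (h \o chart_inv c : _ -> R^o).

(* X is a smooth vector field on the open set W; its values outside W are
   unconstrained and irrelevant. *)
Definition vfield (R : realType) (m : nat) (M : manifold R m)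
    (W : set M) (X : M -> tvec M) : Prop :=
  [/\ open W,
      (forall p, W p -> TM p (X p)) &
      (forall c, atlas c ->
         smooth (chart_map c @` (W `&` chart_dom c)) (fun u => X (chart_inv c u) c))].

(* v(h), computed in a chart c at p (any of them gives the same value). *)
Definition dirder (R : realType) (m : nat) (M : manifold R m)
    (c : chart R m M) (p : M) (v : tvec M) (h : M -> R) : R :=
  'D_(v c) (h \o chart_inv c : _ -> R^o) (chart_map c p).

(* [X, Y] at p, computed in a chart c at p (any of them gives the same value). *)
Definition lie_bracket (R : realType) (m : nat) (M : manifold R m)
    (c : chart R m M) (X Y : M -> tvec M) (p : M) : tvec M :=
  tvec_of c p ('D_(X p c) (fun u => Y (chart_inv c u) c) (chart_map c p)
             - 'D_(Y p c) (fun u => X (chart_inv c u) c) (chart_map c p)).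

Record two_form (R : realType) (m : nat) (M : manifold R m)
    (om : M -> tvec M -> tvec M -> R) : Prop := TwoForm {
  form_linear : forall p (a : R) v w z, TM p v -> TM p w -> TM p z ->
    om p (a *: v + w) z = a * om p v z + om p w z;
  form_antisym : forall p v w, TM p v -> TM p w -> om p v w = - om p w v;
  form_smooth : forall W X Y, vfield W X -> vfield W Y ->
    smooth_fun W (fun p => om p (X p) (Y p)) }.

Definition closed_form (R : realType) (m : nat) (M : manifold R m)
    (om : M -> tvec M -> tvec M -> R) : Prop :=
  forall (W : set M) X Y Z (p : M) c,
    vfield W X -> vfield W Y -> vfield W Z -> W p -> chart_at p c ->
    dirder c p (X p) (fun q => om q (Y q) (Z q))
    - dirder c p (Y p) (fun q => om q (X q) (Z q))
    + dirder c p (Z p) (fun q => om q (X q) (Y q))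
    - om p (lie_bracket c X Y p) (Z p)
    + om p (lie_bracket c X Z p) (Y p)
    - om p (lie_bracket c Y Z p) (X p) = 0.

Record symplectic (R : realType) (m : nat) (M : manifold R m)
    (om : M -> tvec M -> tvec M -> R) : Prop := Symplectic {
  symplectic_form : two_form om;
  symplectic_nondeg : forall p v, TM p v ->
    (forall w, TM p w -> om p v w = 0) -> v = 0;
  symplectic_closed : closed_form om }.

(* Foliation with leaves of dimension k and codimension q, given by a foliated
   atlas: the plaques of a foliated chart are the sets where the last q
   coordinates are constant, and transition maps are locally of the form
   (x, y) |-> (t1 (x, y), t2 y).  The leaves are the classes of the equivalence
   relation generated by lying on a common connected plaque. *)
Record foliation (R : realType) (k q : nat) (M : manifold R (k + q)) := Foliation {
  fol_atlas : set (chart R (k + q) M);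
  fol_sub : fol_atlas `<=` @atlas R (k + q) M;
  fol_cover : forall p, exists2 d, fol_atlas d & chart_dom d p;
  fol_compatible : forall d e p,
    fol_atlas d -> fol_atlas e -> chart_dom d p -> chart_dom e p ->
    exists O : set 'rV[R]_(k + q),
      [/\ open O, O (chart_map d p), O `<=` chart_map d @` (chart_dom d `&` chart_dom e) &
          forall u u', O u -> O u' -> rsubmx u = rsubmx u' ->
            rsubmx (transition d e u) = rsubmx (transition d e u')] }.

(* The tangent space at p of the leaf through p, i.e. of any plaque through p. *)
Definition Tfol (R : realType) (k q : nat) (M : manifold R (k + q))
    (F : foliation M) (p : M) : set (tvec M) :=
  [set v | TM p v /\
           forall d, fol_atlas F d -> chart_dom d p -> rsubmx (v d) = 0].

Definition lagrangian_foliation (R : realType) (n : nat) (M : manifold R (n + n))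
    (om : M -> tvec M -> tvec M -> R) (F : foliation M) : Prop :=
  forall p v, TM p v ->
    (Tfol F p v <-> forall w, Tfol F p w -> om p v w = 0).

Definition transverse (R : realType) (n : nat) (M : manifold R (n + n))
    (F G : foliation M) : Prop :=
  forall p v, TM p v ->
    exists a b, [/\ Tfol F p a, Tfol G p b & v = a + b].

Record bilagrangian (R : realType) (n : nat) (M : manifold R (n + n))
    (om : M -> tvec M -> tvec M -> R) (F G : foliation M) : Prop := BiLagrangian {
  bilag_symplectic : symplectic om;
  bilag_lagF : lagrangian_foliation om F;
  bilag_lagG : lagrangian_foliation om G;
  bilag_transverse : transverse F G }.

(* Affine connection: [nabla p v Y] is the derivative at p, along v in TM p, of
   a vector field Y defined on an open neighbourhood of p. *)
Record affine_connection (R : realType) (m : nat) (M : manifold R m)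
    (nabla : M -> tvec M -> (M -> tvec M) -> tvec M) : Prop := AffineConnection {
  conn_tangent : forall W Y p v, vfield W Y -> W p -> TM p v ->
    TM p (nabla p v Y);
  conn_smooth : forall W X Y, vfield W X -> vfield W Y ->
    vfield W (fun p => nabla p (X p) Y);
  conn_local : forall W Y Z p v, vfield W Y -> vfield W Z ->
    (forall q, W q -> Y q = Z q) -> W p -> TM p v -> nabla p v Y = nabla p v Z;
  conn_linear : forall W Y p (a : R) v w, vfield W Y -> W p ->
    TM p v -> TM p w ->
    nabla p (a *: v + w) Y = a *: nabla p v Y + nabla p w Y;
  conn_add : forall W Y Z p v, vfield W Y -> vfield W Z -> W p -> TM p v ->
    nabla p v (fun q => Y q + Z q) = nabla p v Y + nabla p v Z;
  conn_leibniz : forall W h Y p v c,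
    smooth_fun W h -> vfield W Y -> W p -> TM p v -> chart_at p c ->
    nabla p v (fun q => h q *: Y q) = dirder c p v h *: Y p + h p *: nabla p v Y }.

Definition section_of (R : realType) (k q : nat) (M : manifold R (k + q))
    (F : foliation M) (W : set M) (X : M -> tvec M) : Prop :=
  vfield W X /\ forall p, W p -> Tfol F p (X p).

Record bilagrangian_connection (R : realType) (n : nat) (M : manifold R (n + n))
    (om : M -> tvec M -> tvec M -> R) (F G : foliation M)
    (nabla : M -> tvec M -> (M -> tvec M) -> tvec M) : Prop := BiLagConn {
  bilag_conn : affine_connection nabla;
  bilag_conn_om : forall W Y Z p v c,
    vfield W Y -> vfield W Z -> W p -> TM p v -> chart_at p c ->
    dirder c p v (fun q => om q (Y q) (Z q))
    = om p (nabla p v Y) (Z p) + om p (Y p) (nabla p v Z);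
  bilag_conn_F : forall W Y p v, section_of F W Y -> W p -> TM p v ->
    Tfol F p (nabla p v Y);
  bilag_conn_G : forall W Y p v, section_of G W Y -> W p -> TM p v ->
    Tfol G p (nabla p v Y);
  bilag_conn_torsion : forall W X Y p c,
    section_of F W X -> section_of G W Y -> W p -> chart_at p c ->
    nabla p (X p) Y - nabla p (Y p) X = lie_bracket c X Y p }.

(* R(X, Y)Z at p, the bracket being computed in a chart c at p. *)
Definition curvature (R : realType) (m : nat) (M : manifold R m)
    (nabla : M -> tvec M -> (M -> tvec M) -> tvec M) (c : chart R m M)
    (X Y Z : M -> tvec M) (p : M) : tvec M :=
  nabla p (X p) (fun q => nabla q (Y q) Z)
  - nabla p (Y p) (fun q => nabla q (X q) Z)
  - nabla p (lie_bracket c X Y p) Z.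

Definition flat_on (R : realType) (m : nat) (M : manifold R m)
    (nabla : M -> tvec M -> (M -> tvec M) -> tvec M) (U : set M) : Prop :=
  forall W X Y Z p c, vfield W X -> vfield W Y -> vfield W Z ->
    U p -> W p -> chart_at p c -> curvature nabla c X Y Z p = 0.

(* The coordinates of a chart on a 2n-manifold are (x, y), with x the first n
   ones ([lshift]) and y the last n ones ([rshift]). *)
Definition Tx (R : realType) (n : nat) (M : manifold R (n + n))
    (c : chart R (n + n) M) (p : M) : set (tvec M) :=
  [set v | TM p v /\ forall i : 'I_n, dcoord c (rshift n i) v = 0].

Definition Ty (R : realType) (n : nat) (M : manifold R (n + n))
    (c : chart R (n + n) M) (p : M) : set (tvec M) :=
  [set v | TM p v /\ forall i : 'I_n, dcoord c (lshift n i) v = 0].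

Definition mixed_matrix (R : realType) (n : nat) (M : manifold R (n + n))
    (om : M -> tvec M -> tvec M -> R) (c : chart R (n + n) M)
    (x y : 'rV[R]_n) : 'M[R]_n :=
  let p := chart_inv c (row_mx x y) in
  \matrix_(i, j) om p (coord_field c (lshift n i) p)
                      (coord_field c (rshift n j) p).

(* Main.v *)
Require Import Defs.
From HB Require Import structures.
From mathcomp Require Import all_boot all_order all_algebra.
From mathcomp Require Import all_classical all_reals all_analysis.
Import Order.TTheory GRing.Theory Num.Theory.
Import numFieldNormedType.Exports.
Local Open Scope classical_set_scope.
Local Open Scope ring_scope.

(** Write [A] for the matrix of [om] between the [x]- and the [y]-coordinate
    fields.  Both families of coordinate planes are Lagrangian, so [A] determines
    [om] ([om_coords]) and is invertible ([mixed_unit]).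

    The connection preserves both foliations and has no torsion on mixed pairs.
    Hence, for commuting sections [X] of [F] and [Y] of [G], the vectors
    [nabla_X Y] and [nabla_Y X] are equal, and lie one in [TG] and one in [TF]:
    both vanish ([nabla_commuting]).  For coordinate fields, compatibility with
    [om] then gives [om (nabla_(d/dx_k) d/dx_i, d/dy_j) = d A_ij / dx_k], and
    symmetrically in [y]: the connection matrices are [A_x A^-1] and
    [A^-1 A_y].

    Flat implies factorized.  Pairing the curvature [R (d/dx, d/dy) d/dx] with
    [d/dy] turns its vanishing into [A_xy = A_x A^-1 A_y] ([flat_mixed_eq]).
    This says that the logarithmic derivative [A_x A^-1] does not depend on [y]
    ([log_derivative_cst]).  So [A (x, 0)^-1 A (x, y)] does not depend on [x], and
    [A (x, y) = A (x, 0) A (0, 0)^-1 A (0, y)] ([mixed_eq_factor]).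

    Factorized implies flat.  If [A = f g], the frame
    [xi = f^-1 d/dx], [eta = g^-T d/dy] is dual with respect to [om], with
    constant pairings, and its mixed brackets vanish, since [xi] depends on [x]
    only and [eta] on [y] only.  The argument given above for coordinate fields now
    shows that the frame is parallel ([xi_parallel], [eta_parallel]).  A
    parallel field [E] satisfies [om (nabla_V Z, E) = V (om (Z, E))], so pairing the
    curvature with [E] leaves [[X, Y] h - (X (Y h) - Y (X h))] up to sign, with
    [h = om (Z, E)]; this is zero ([curvature_parallel],
    [bracket_commutator]), and such fields span.

    Curvatures are never expanded in a frame: every identity between tangent
    vectors is tested against [om], which turns covariant derivatives into
    directional derivatives of functions. *)

Set Implicit Arguments.
Unset Strict Implicit.
Unset Printing Implicit Defensive.

(** * Iterated differentiability *)

Section NearEq.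
Variables (R : realType) (V W : normedModType R).
Implicit Types (f g : V -> W) (a v : V).

Lemma differentiable_near0 f a :
  (\forall u \near a, f u = 0) -> differentiable f a.
Proof.
move=> f0.
have f0' : f \o shift a = cst (f a) + (\0 : V -> W) +o_ (0 : V) id.
  apply/eqaddoP => _/posnumP[e].
  have : \forall u \near (0 : V), f (u + a) = 0.
    by move: f0; rewrite (near_shift 0 a) subr0.
  apply: filterS => u fu; rewrite /= !fctE /= fu (nbhs_singleton f0).
  by rewrite !addr0 subr0 normr0 mulr_ge0.
have d0 : 'd f a = (\0 : V -> W) :> (V -> W).
  by apply: diff_unique => // x; exact: cvg_cst.
by apply/diff_locallyP; rewrite d0; split => // x; exact: cvg_cst.
Qed.

Lemma near_eq_differentiable f g a :
  (\forall u \near a, f u = g u) -> differentiable f a -> differentiable g a.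
Proof.
move=> fg df; have -> : g = f + (g - f) by rewrite addrC subrK.
apply: differentiableD => //; apply: differentiable_near0.
by apply: filterS fg => u /= fgu; rewrite !fctE fgu subrr.
Qed.

Lemma near_eq_diff f g a v :
  (\forall u \near a, f u = g u) -> differentiable f a ->
  'd f a v = 'd g a v.
Proof.
move=> fg df; rewrite -!deriveE //; first exact: near_eq_derive.
exact: near_eq_differentiable df.
Qed.

End NearEq.

Lemma derive_lin_comp (R : realType) (V W W' : normedModType R)
  (L : {linear W -> W'}) (f : V -> W) a v :
  continuous L -> differentiable f a -> 'D_v (fun u => L (f u)) a = L ('D_v f a).
Proof.
move=> Lc df.
have dL : differentiable L (f a) by exact: linear_differentiable.
by rewrite deriveE ?(diff_comp df dL) /= ?diff_lin ?deriveE //;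
  exact: differentiable_comp.
Qed.

Section Kdiff.
Variables (R : realType) (m : nat).
Implicit Types (U V : set 'rV[R]_m) (k : nat).

Lemma kdiff_sub (W : normedModType R) k U V (f : 'rV[R]_m -> W) :
  U `<=` V -> kdiff k V f -> kdiff k U f.
Proof.
move=> UV; elim: k f => //= k IH f [df kf]; split => [u /UV /df//|i].
exact: IH.
Qed.

(** Only the values on [U] count, although derivatives are taken in the ambient
    space: this is where [U] must be open. *)
Lemma kdiff_ext (W : normedModType R) k U (f g : 'rV[R]_m -> W) :
  open U -> (forall u, U u -> f u = g u) -> kdiff k U f -> kdiff k U g.
Proof.
move=> oU; elim: k f g => //= k IH f g fg [df kf].
have nfg u : U u -> \forall x \near u, f x = g x.
  by move=> Uu; apply: filterS (open_nbhs_nbhs (conj oU Uu)).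
split => [u Uu|i]; first exact: near_eq_differentiable (nfg u Uu) (df u Uu).
by apply: IH (kf i) => u Uu; apply: near_eq_derive; exact: nfg.
Qed.

Lemma kdiff_mono (W : normedModType R) k U (f : 'rV[R]_m -> W) :
  kdiff k.+1 U f -> kdiff k U f.
Proof.
elim: k f => // k IH f [df kf]; split => // i; exact: (IH _ (kf i)).
Qed.

Lemma kdiff_cst (W : normedModType R) k U (w : W) : kdiff k U (fun=> w).
Proof.
elim: k w => //= k IH w; split => [u _|i]; first exact: differentiable_cst.
have -> : (fun u => 'D_(delta_mx 0 i) (fun _ : 'rV[R]_m => w) u) = (fun=> 0).
  by apply/funext => u; exact: derive_cst.
exact: IH.
Qed.

Lemma kdiffD (W : normedModType R) k U (f g : 'rV[R]_m -> W) :
  open U -> kdiff k U f -> kdiff k U g -> kdiff k U (fun u => f u + g u).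
Proof.
move=> oU; elim: k f g => //= k IH f g [df kf] [dg kg].
split => [u Uu|i]; first exact: differentiableD (df u Uu) (dg u Uu).
apply: kdiff_ext (IH _ _ (kf i) (kg i)) => // u Uu.
by rewrite [RHS]deriveD //; apply: diff_derivable; [exact: df | exact: dg].
Qed.

Lemma kdiff_sum (W : normedModType R) k U (I : Type) (s : seq I)
  (P : pred I) (f : I -> 'rV[R]_m -> W) :
  open U -> (forall i, kdiff k U (f i)) ->
  kdiff k U (fun u => \sum_(i <- s | P i) f i u).
Proof.
move=> oU kf; elim: s => [|i s IH].
  by apply: kdiff_ext (kdiff_cst k U 0) => // u _; rewrite big_nil.
case Pi : (P i).
  by apply: kdiff_ext (kdiffD oU (kf i) IH) => // u _; rewrite big_cons Pi.
by apply: kdiff_ext IH => // u _; rewrite big_cons Pi.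
Qed.

Lemma kdiff_lin_comp (W W' : normedModType R) k U (L : {linear W -> W'})
  (f : 'rV[R]_m -> W) :
  open U -> continuous L -> kdiff k U f -> kdiff k U (fun u => L (f u)).
Proof.
move=> oU Lc; elim: k f => //= k IH f [df kf].
split => [u Uu|i].
  by apply: differentiable_comp (df u Uu) _; exact: linear_differentiable.
apply: kdiff_ext (IH _ (kf i)) => // u Uu.
by rewrite derive_lin_comp //; exact: df.
Qed.

(** By induction on the order: the Leibniz rule expresses the first derivatives
    through products of functions that are differentiable to the lower order. *)
Lemma kdiffM k U (f g : 'rV[R]_m -> R^o) :
  open U -> kdiff k U f -> kdiff k U g ->
  kdiff k U (fun u => f u * g u : R^o).
Proof.
move=> oU; elim: k f g => // k IH f g kf kg.
have [df dkf] := kf; have [dg dkg] := kg.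
have [kf' kg'] := (kdiff_mono kf, kdiff_mono kg).
split => [u Uu|i]; first exact: (differentiableM (df u Uu) (dg u Uu)).
apply: kdiff_ext (kdiffD oU (IH _ _ kf' (dkg i)) (IH _ _ kg' (dkf i))) => // u Uu.
have hf : derivable f u (delta_mx 0 i) by exact: diff_derivable (df u Uu).
have hg : derivable g u (delta_mx 0 i) by exact: diff_derivable (dg u Uu).
exact/esym/(deriveM hf hg).
Qed.

(** The derivative of [1 / f] is [- (1 / f) * (1 / f) * f'], which involves [1 /
    f] at the lower order only. *)
Lemma kdiffV k U (f : 'rV[R]_m -> R^o) :
  open U -> (forall u, U u -> f u != 0) -> kdiff k U f ->
  kdiff k U (fun u => (f u)^-1 : R^o).
Proof.
move=> oU f0; elim: k => // k IH kf.
have kV := IH (kdiff_mono kf); have [df dkf] := kf.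
split => [u Uu|i]; first exact: (differentiableV (df u Uu) (f0 u Uu)).
have k1 := kdiffM oU (kdiff_cst k U (-1 : R^o)) (kdiffM oU (kdiffM oU kV kV) (dkf i)).
apply: kdiff_ext k1 => // u Uu.
have hf : derivable f u (delta_mx 0 i) by exact: diff_derivable (df u Uu).
have -> := deriveV (f0 u Uu) hf.
by rewrite mulN1r [RHS]mulNr -mulNr -mulNr expr2 invfM.
Qed.

Lemma kdiff_prod k U (I : Type) (s : seq I) (f : I -> 'rV[R]_m -> R^o) :
  open U -> (forall i, kdiff k U (f i)) ->
  kdiff k U (fun u => \prod_(i <- s) f i u : R^o).
Proof.
move=> oU kf; elim: s => [|i s IH].
  by apply: kdiff_ext (kdiff_cst k U (1 : R^o)) => // u _; rewrite big_nil.
by apply: kdiff_ext (kdiffM oU (kf i) IH) => // u _; rewrite big_cons.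
Qed.

End Kdiff.

(** * Matrix-valued functions and directional derivatives *)

Section Entries.
Variables (R : realType) (p q : nat).

Definition entry i j (A : 'M[R]_(p, q)) : R^o := A i j.

Fact entry_is_linear i j : linear (entry i j).
Proof. by move=> a A B; rewrite /entry !mxE. Qed.

HB.instance Definition _ i j :=
  GRing.isLinear.Build R 'M[R]_(p, q) R^o _ (entry i j) (entry_is_linear i j).

Lemma entry_continuous i j : continuous (entry i j).
Proof. exact: coord_continuous. Qed.

(** A matrix-valued function is the sum of its entries scaled onto elementary
    matrices, so that scalar results transfer to matrices through this
    continuous linear map. *)
Definition scale_on (W : normedModType R) (w : W) (a : R^o) : W := a *: w.

Fact scale_on_is_linear (W : normedModType R) (w : W) : linear (scale_on w).
Proof. by move=> a b c; rewrite /scale_on scalerDl scalerA. Qed.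

HB.instance Definition _ (W : normedModType R) (w : W) :=
  GRing.isLinear.Build R R^o W _ (scale_on w) (scale_on_is_linear w).

Lemma scale_on_continuous (W : normedModType R) (w : W) : continuous (scale_on w).
Proof. exact: scalel_continuous. Qed.

Lemma derive_entry (V : normedModType R) (F : V -> 'M[R]_(p, q)) a v i j :
  differentiable F a -> 'D_v (fun u => F u i j : R^o) a = 'D_v F a i j.
Proof.
move=> dF.
by rewrite -[LHS]/('D_v (fun u => entry i j (F u)) a)
  (derive_lin_comp v (@entry_continuous i j) dF).
Qed.

Lemma kdiff_mxP m k (U : set 'rV[R]_m) (F : 'rV[R]_m -> 'M[R]_(p, q)) :
  open U ->
  kdiff k U F <-> forall i j, kdiff k U (fun u => F u i j : R^o).
Proof.
move=> oU; split => [kF i j|kF].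
  exact: (kdiff_lin_comp oU (@entry_continuous i j) kF).
pose s u := \sum_i \sum_j scale_on (delta_mx i j) (F u i j : R^o).
have ks : kdiff k U s.
  apply: kdiff_sum => // i; apply: kdiff_sum => // j.
  exact: (kdiff_lin_comp oU (@scale_on_continuous _ _) (kF i j)).
apply: kdiff_ext ks => // u _; rewrite [RHS]matrix_sum_delta.
by apply: eq_bigr => i _; apply: eq_bigr.
Qed.

Lemma differentiable_mxP (V : normedModType R) (F : V -> 'M[R]_(p, q)) a :
  differentiable F a <-> forall i j, differentiable (fun u => F u i j : R^o) a.
Proof.
split => [dF i j|dF].
  apply: (@differentiable_comp _ _ _ _ F (entry i j)) => //.
  exact/linear_differentiable/entry_continuous.
have -> : F = \sum_(i < p) \sum_(j < q)
    (scale_on (delta_mx i j) \o (fun u => F u i j : R^o)).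
  apply/funext => u; rewrite fct_sumE [LHS]matrix_sum_delta.
  by apply: eq_bigr => i _; rewrite fct_sumE.
apply: differentiable_sum => i; apply: differentiable_sum => j.
by apply: differentiable_comp => //; exact: (linear_differentiable (@scale_on_continuous _ _)).
Qed.

End Entries.

Section Directional.
Variables (R : realType).

Lemma derive_coordE m (W : normedModType R) (f : 'rV[R]_m -> W) a v :
  differentiable f a -> 'D_v f a = \sum_i v 0 i *: 'D_(delta_mx 0 i) f a.
Proof.
move=> df; rewrite deriveE // {1}[v]row_sum_delta linear_sum.
by apply: eq_bigr => i _; rewrite linearZ deriveE.
Qed.

Lemma derive_comp (U V W : normedModType R) (f : U -> V) (g : V -> W) a v :
  differentiable f a -> differentiable g (f a) ->
  'D_v (g \o f) a = 'D_('D_v f a) g (f a).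
Proof.
move=> df dg; rewrite !deriveE //; last exact: differentiable_comp.
by rewrite (diff_comp df dg).
Qed.

Lemma kdiff_id m k (U : set 'rV[R]_m) : kdiff k U (fun u => u).
Proof.
case: k => //= k; split => [u _|i]; first exact: ex_diff.
have -> : 'D_(delta_mx 0 i) (fun u : 'rV[R]_m => u) = (fun=> delta_mx 0 i).
  by apply/funext => u; exact: derive_id.
exact: kdiff_cst.
Qed.

(** By the chain rule, the first derivatives of the composite are sums of
    products of a derivative of [phi] with a composite [(D_a f) (phi u)], to
    which the induction hypothesis applies. *)
Lemma kdiff_comp m p k (U : set 'rV[R]_m) (V : set 'rV[R]_p)
    (phi : 'rV[R]_m -> 'rV[R]_p) (f : 'rV[R]_p -> R^o) :
  open U -> (forall u, U u -> V (phi u)) ->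
  kdiff k U phi -> kdiff k V f -> kdiff k U (fun u => f (phi u)).
Proof.
move=> oU UV; elim: k f => // k IH f kphi kf.
have [dphi dkphi] := kphi; have [df dkf] := kf.
split => [u Uu|i].
  exact: differentiable_comp (dphi u Uu) (df _ (UV u Uu)).
have kS : kdiff k U (fun u => \sum_(a < p)
    (('D_(delta_mx 0 i) phi u) 0 a * 'D_(delta_mx 0 a) f (phi u)) : R^o).
  apply: kdiff_sum => // a; apply: kdiffM => //.
    by move: (dkphi i) => /(kdiff_mxP _ _ oU); apply.
  by apply: IH (kdiff_mono kphi) (dkf a).
apply: kdiff_ext kS => // u Uu.
rewrite -[RHS]/('D_(delta_mx 0 i) (f \o phi) u).
rewrite (derive_comp _ (dphi u Uu) (df _ (UV u Uu))).
by rewrite (derive_coordE _ (df _ (UV u Uu))).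
Qed.

Lemma kdiff_comp_mx m p r s k (U : set 'rV[R]_m) (V : set 'rV[R]_p)
    (phi : 'rV[R]_m -> 'rV[R]_p) (F : 'rV[R]_p -> 'M[R]_(r, s)) :
  open U -> open V -> (forall u, U u -> V (phi u)) ->
  kdiff k U phi -> kdiff k V F -> kdiff k U (fun u => F (phi u)).
Proof.
move=> oU oV UV kphi /(kdiff_mxP _ _ oV) kF; apply/kdiff_mxP => // i j.
exact: kdiff_comp oU UV kphi (kF i j).
Qed.

End Directional.

Section MatrixFunctions.
Variables (R : realType) (m k : nat) (U : set 'rV[R]_m).
Hypothesis oU : open U.

Lemma kdiff_mulmx p q r (F : 'rV[R]_m -> 'M[R]_(p, q))
    (G : 'rV[R]_m -> 'M[R]_(q, r)) :
  kdiff k U F -> kdiff k U G -> kdiff k U (fun u => F u *m G u).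
Proof.
move=> /(kdiff_mxP _ _ oU) kF /(kdiff_mxP _ _ oU) kG; apply/kdiff_mxP => // i j.
have kS : kdiff k U (fun u => \sum_l (F u i l * G u l j) : R^o).
  by apply: kdiff_sum => // l; exact: kdiffM.
by apply: kdiff_ext kS => // u _; rewrite mxE.
Qed.

Lemma kdiff_row_mx p q r (F : 'rV[R]_m -> 'M[R]_(p, q))
    (G : 'rV[R]_m -> 'M[R]_(p, r)) :
  kdiff k U F -> kdiff k U G -> kdiff k U (fun u => row_mx (F u) (G u)).
Proof.
move=> /(kdiff_mxP _ _ oU) kF /(kdiff_mxP _ _ oU) kG; apply/kdiff_mxP => // i j.
case: (splitP j) => l jl; [apply: kdiff_ext (kF i l)|apply: kdiff_ext (kG i l)];
  move=> // u _.
  by rewrite (_ : j = lshift r l) ?row_mxEl //; exact: val_inj.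
by rewrite (_ : j = rshift q l) ?row_mxEr //; exact: val_inj.
Qed.

Lemma kdiff_det p (F : 'rV[R]_m -> 'M[R]_p) :
  (forall i j, kdiff k U (fun u => F u i j : R^o)) ->
  kdiff k U (fun u => \det (F u) : R^o).
Proof.
move=> kF; rewrite /determinant; apply: kdiff_sum => // s.
by apply: kdiffM => //; [exact: kdiff_cst | exact: kdiff_prod].
Qed.

(** Cramer's rule: the entries of the inverse are polynomials in those of the
    matrix, divided by the determinant. *)
Lemma kdiff_invmx p (F : 'rV[R]_m -> 'M[R]_p) :
  (forall u, U u -> F u \in unitmx) ->
  kdiff k U F -> kdiff k U (fun u => invmx (F u)).
Proof.
move=> uF /(kdiff_mxP _ _ oU) kF; apply/kdiff_mxP => // i j.
have kadj : kdiff k U (fun u => \adj (F u) i j : R^o).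
  have kc : kdiff k U (fun u => (-1) ^+ (j + i) *
      \det (row' j (col' i (F u))) : R^o).
    apply: kdiffM => //; first exact: kdiff_cst.
    apply: kdiff_det => a b; apply: kdiff_ext (kF (lift j a) (lift i b)) => //.
    by move=> u _; rewrite !mxE.
  by apply: kdiff_ext kc => // u _; rewrite !mxE.
have kV : kdiff k U (fun u => (\det (F u))^-1 : R^o).
  apply: kdiffV => //; last exact: kdiff_det.
  by move=> u /uF; rewrite unitmxE unitfE.
apply: kdiff_ext (kdiffM oU kV kadj) => // u /uF uFu.
by rewrite /invmx uFu [RHS]mxE.
Qed.

End MatrixFunctions.

Section DeriveMx.
Variables (R : realType) (V : normedModType R).

Lemma mulmx_entryE p q r (F : V -> 'M[R]_(p, q)) (G : V -> 'M[R]_(q, r)) i j :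
  (fun u => (F u *m G u) i j : R^o) =
  \sum_l ((fun u => F u i l : R^o) * (fun u => G u l j : R^o)).
Proof. by apply/funext => u; rewrite mxE fct_sumE. Qed.

Lemma differentiable_entryM p q r (F : V -> 'M[R]_(p, q)) (G : V -> 'M[R]_(q, r))
    a i l j : differentiable F a -> differentiable G a ->
  differentiable ((fun u => F u i l : R^o) * (fun u => G u l j : R^o) : V -> R^o) a.
Proof.
by move=> /differentiable_mxP dF /differentiable_mxP dG;
  exact: (differentiableM (dF i l) (dG l j)).
Qed.

Lemma differentiable_mulmx p q r (F : V -> 'M[R]_(p, q)) (G : V -> 'M[R]_(q, r)) a :
  differentiable F a -> differentiable G a ->
  differentiable (fun u => F u *m G u) a.
Proof.
move=> dF dG; apply/differentiable_mxP => i j; rewrite mulmx_entryE.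
by apply: differentiable_sum => l; exact: differentiable_entryM.
Qed.

Lemma derive_mulmx p q r (F : V -> 'M[R]_(p, q)) (G : V -> 'M[R]_(q, r)) a v :
  differentiable F a -> differentiable G a ->
  'D_v (fun u => F u *m G u) a = 'D_v F a *m G a + F a *m 'D_v G a.
Proof.
move=> dF dG; apply/matrixP => i j.
rewrite -(derive_entry _ _ _ (differentiable_mulmx dF dG)) mulmx_entryE.
rewrite derive_sum; last first.
  by move=> l; exact: diff_derivable (differentiable_entryM i l j dF dG).
rewrite !mxE -big_split /=; apply: eq_bigr => l _.
have hF : derivable (fun u => F u i l : R^o) a v.
  by apply: diff_derivable; move/differentiable_mxP: dF; apply.
have hG : derivable (fun u => G u l j : R^o) a v.
  by apply: diff_derivable; move/differentiable_mxP: dG; apply.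
rewrite -(derive_entry _ _ _ dF) -(derive_entry _ _ _ dG).
rewrite [LHS](deriveM hF hG) addrC; congr (_ + _); exact: mulrC.
Qed.

End DeriveMx.

(** * Functions along segments, and the symmetry of second derivatives *)

Section Line.
Variables (R : realType) (V : normedModType R).

Lemma differentiable_line (u v : V) (s : R) :
  differentiable (fun s : R => u + s *: v) s.
Proof.
exact: (@differentiableD _ _ _ (cst u) (fun s : R => s *: v)).
Qed.

Lemma derive_line (u v : V) (s : R) : 'D_1 (fun s : R => u + s *: v) s = v.
Proof.
rewrite -[fun _ => _]/(cst u + ( *:%R^~ v)) deriveD //; last exact: diff_derivable.
by rewrite derive_cst add0r deriveE // diff_val scale1r.
Qed.

(** The mean value theorem applied to the restriction of [f] to the segment. *)
Lemma line_MVT (f : V -> R^o) (u v : V) :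
  (forall s : R, 0 <= s <= 1 -> differentiable f (u + s *: v)) ->
  exists2 s : R, 0 <= s <= 1 & f (u + v) - f u = 'D_v f (u + s *: v).
Proof.
move=> df; pose phi (s : R) : R := f (u + s *: v).
have dphi (s : R) : 0 <= s <= 1 -> differentiable phi s.
  move=> s01; apply: (@differentiable_comp _ _ _ _ (fun s : R => u + s *: v) f).
    exact: differentiable_line.
  exact: df.
have Dphi (s : R) : 0 <= s <= 1 -> is_derive s 1 phi ('D_v f (u + s *: v)).
  move=> s01; apply: DeriveDef; first exact: diff_derivable (dphi s s01).
  have -> : 'D_v f (u + s *: v) =
      'D_('D_1 (fun s : R => u + s *: v) s) f (u + s *: v) by rewrite derive_line.
  apply: (@derive_comp _ _ _ _ (fun s : R => u + s *: v) f); last exact: df.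
  exact: differentiable_line.
have [| |s s01 E] := @MVT R phi (fun s => 'D_v f (u + s *: v)) 0 1 ltr01.
- by move=> s /itvP s01; apply: Dphi; rewrite !s01.
- apply: derivable_within_continuous => s /itvP s01.
  by apply: ex_derive; apply: Dphi; rewrite !s01.
exists s; first by rewrite !(itvP s01).
by move: E; rewrite /phi scale1r scale0r addr0 subr0 mulr1.
Qed.

Lemma derive_eq0_cst (f : V -> R^o) (u v : V) :
  (forall s : R, 0 <= s <= 1 -> differentiable f (u + s *: v)) ->
  (forall s : R, 0 <= s <= 1 -> 'D_v f (u + s *: v) = 0) ->
  f (u + v) = f u.
Proof.
move=> df Df; have [s s01 E] := line_MVT df.
by apply/eqP; rewrite -subr_eq0 E Df.
Qed.

(** Differentiability is not assumed: all the difference quotients in this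
    direction vanish. *)
Lemma derive_along_cst (W : normedModType R) (f : V -> W) (u v : V) :
  (forall h : R, f (h *: v + u) = f u) -> 'D_v f u = 0.
Proof.
move=> fE; rewrite /derive; apply/lim_near_cst => //=.
by near=> h; rewrite fE subrr scaler0.
Unshelve. all: by end_near. Qed.

End Line.


Section Clairaut.
Variables (R : realType).

Lemma differentiable_translate (V W : normedModType R) (f : V -> W) (w x : V) :
  differentiable f (x + w) -> differentiable (fun y => f (y + w)) x.
Proof.
move=> df; exact: (@differentiable_comp _ _ _ _ (fun y : V => y + w) f).
Qed.

Lemma derive_translate (V W : normedModType R) (f : V -> W) (w x v : V) :
  'D_v (fun y => f (y + w)) x = 'D_v f (x + w).
Proof.
rewrite /derive.
have -> // : (fun h : R => h^-1 *: (((fun y => f (y + w)) \o shift x) (h *: v) - f (x + w)))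
  = (fun h => h^-1 *: ((f \o shift (x + w)) (h *: v) - f (x + w))).
by apply/funext => h /=; rewrite addrA.
Qed.

(** Two applications of the mean value theorem: to [x |-> f (x + w) - f x] along
    [v], then to ['D_v f] along [w]. *)
Lemma second_difference (V : normedModType R) (f : V -> R^o) (u v w : V) :
  (forall a b : R, 0 <= a <= 1 -> 0 <= b <= 1 ->
     differentiable f (u + a *: v + b *: w)) ->
  (forall a b : R, 0 <= a <= 1 -> 0 <= b <= 1 ->
     differentiable ('D_v f) (u + a *: v + b *: w)) ->
  exists a b : R, [/\ 0 <= a <= 1, 0 <= b <= 1 &
    f (u + v + w) - f (u + v) - (f (u + w) - f u) =
    'D_w ('D_v f) (u + a *: v + b *: w)].
Proof.
move=> df dDf; have I0 : 0 <= (0 : R) <= 1 by rewrite lexx ler01.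
have I1 : 0 <= (1 : R) <= 1 by rewrite lexx ler01.
pose phi (x : V) : R^o := f (x + w) - f x.
have df0 (s : R) : 0 <= s <= 1 -> differentiable f (u + s *: v).
  by move=> s01; have := df s 0 s01 I0; rewrite scale0r addr0.
have df1 (s : R) : 0 <= s <= 1 -> differentiable (fun y => f (y + w)) (u + s *: v).
  by move=> s01; apply: differentiable_translate; have := df s 1 s01 I1; rewrite scale1r.
have [a a01] : exists2 s : R, 0 <= s <= 1 &
    phi (u + v) - phi u = 'D_v phi (u + s *: v).
  apply: line_MVT => s s01.
  exact: (differentiableB (df1 s s01) (df0 s s01)).
rewrite [X in _ = X](@deriveB _ _ _ (fun y => f (y + w)) f);
  [|exact/diff_derivable/df1|exact/diff_derivable/df0].
rewrite derive_translate => E.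
have [b b01 Eb] := line_MVT (fun s s01 => dDf a s a01 s01).
by exists a, b; split => //; rewrite -Eb -E.
Qed.

(** The distance from [f u] to [g u] is at most [`|f u - f x| + `|g y - g u|],
    which is small when [x] and [y] are close to [u]. *)
Lemma continuous_eq_at (V : normedModType R) (f g : V -> R^o) (u : V) :
  {for u, continuous f} -> {for u, continuous g} ->
  (forall r : R, 0 < r -> exists x y, [/\ ball u r x, ball u r y & f x = g y]) ->
  f u = g u.
Proof.
move=> cf cg fg; apply/eqP; rewrite -subr_eq0 -normr_eq0.
apply/eqP/le_anti; rewrite normr_ge0 andbT.
apply/ler_addgt0Pr => e e0; rewrite add0r.
have e2 : 0 < e / 2 by rewrite divr_gt0.
have : \forall x \near u, `|f u - f x| < e / 2 /\ `|g u - g x| < e / 2.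
  have cfe := proj1 (cvgrPdist_lt _ _) cf _ e2.
  have cge := proj1 (cvgrPdist_lt _ _) cg _ e2.
  near=> x; split; near: x; [exact: cfe|exact: cge].
move=> /nbhs_ballP[r /= r0 rP]; have [x [y [/rP[fx _] /rP[_ gy] fxy]]] := fg r r0.
apply: le_trans (_ : e / 2 + e / 2 <= _); last by rewrite -splitr.
rewrite -(subrKA (f x)); apply: le_trans (ler_normD _ _) _.
by apply: lerD; [exact: ltW | rewrite fxy distrC ltW].
Unshelve. all: by end_near. Qed.

(** The second difference of [f] over a small parallelogram is symmetric in its
    two sides, and equals a mixed second derivative at some point of it, in
    either order of differentiation; these derivatives are continuous. *)
Lemma clairaut m (U : set 'rV[R]_m) (f : 'rV[R]_m -> R^o) u i j :
  open U -> U u -> kdiff 3 U f ->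
  'D_(delta_mx 0 i) ('D_(delta_mx 0 j) f) u = 'D_(delta_mx 0 j) ('D_(delta_mx 0 i) f) u.
Proof.
move=> oU Uu kf; have df : forall x, U x -> differentiable f x by case: kf.
have d1 l x : U x -> differentiable ('D_(delta_mx 0 l) f) x.
  by move=> Ux; have [_ /(_ l)[+ _]] := kf; exact.
have d2 l l' : {for u, continuous ('D_(delta_mx 0 l) ('D_(delta_mx 0 l') f) : _ -> R^o)}.
  apply: differentiable_continuous.
  by have [_ /(_ l')[_ /(_ l)[+ _]]] := kf; exact.
set di : 'rV[R]_m := delta_mx 0 i; set dj : 'rV[R]_m := delta_mx 0 j.
apply: (continuous_eq_at (d2 i j) (d2 j i)) => r' r'0.
have : \forall x \near u, U x /\ ball u r' x.
  by near=> x; split; near: x; [exact: open_nbhs_nbhs|exact: nbhsx_ballx].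
move=> /nbhs_ballP[r /= r0 rP].
(* With [t = r / (2 N)], a parallelogram of sides [t di] and [t dj] at [u] stays
   in the ball of radius [r]. *)
pose N := `|di| + `|dj| + 1; have N0 : 0 < N by rewrite ltr_wpDl ?addr_ge0.
pose t := r / (N * 2); have t0 : 0 < t by rewrite divr_gt0 // mulr_gt0.
have small (a b : R) : 0 <= a <= 1 -> 0 <= b <= 1 ->
    ball u r (u + a *: (t *: di) + b *: (t *: dj)).
  move=> /andP[a0 a1] /andP[b0 b1].
  rewrite -ball_normE /= -addrA opprD addrA subrr sub0r normrN.
  apply: le_lt_trans (ler_normD _ _) _.
  have nt (x : 'rV[R]_m) : `|t *: x| = t * `|x| by rewrite normrZ gtr0_norm.
  rewrite [`|a *: _|]normrZ [`|b *: _|]normrZ !nt (ger0_norm a0) (ger0_norm b0).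
  have tN : t * N = r / 2 
    by rewrite /t -mulrA invfM mulrAC mulVf ?gt_eqF // mul1r.
  have le1 : a * (t * `|di|) + b * (t * `|dj|) <= t * N.
    apply: (@le_trans _ _ (t * `|di| + t * `|dj|)).
      by apply: lerD; rewrite ler_piMl // mulr_ge0 // ltW.
    by rewrite -mulrDr ler_pM2l // lerDl.
  by rewrite (le_lt_trans le1) // tN ltr_pdivrMr // mulr_natr mulr2n ltrDl.
have DZ l x : U x -> 'D_(t *: delta_mx 0 l) f x = t *: 'D_(delta_mx 0 l) f x.
  by move=> Ux; rewrite !deriveE ?linearZ //; exact: df.
have dZ l x : U x -> differentiable ('D_(t *: delta_mx 0 l) f) x.
  move=> Ux; apply: near_eq_differentiable (differentiableZ t (d1 l x Ux)).
  by apply: filterS (open_nbhs_nbhs (conj oU Ux)) => y Uy; rewrite DZ.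
have DDZ l l' x : U x -> 'D_(t *: delta_mx 0 l) ('D_(t *: delta_mx 0 l') f) x =
    t * t * 'D_(delta_mx 0 l) ('D_(delta_mx 0 l') f) x.
  move=> Ux; rewrite deriveE; last exact: dZ.
  rewrite linearZ /= -deriveE; last exact: dZ.
  rewrite (@near_eq_derive _ _ _ _ (t *: 'D_(delta_mx 0 l') f)); last first.
    by apply: filterS (open_nbhs_nbhs (conj oU Ux)) => y Uy; rewrite DZ.
  by rewrite deriveZ ?scalerA //; exact/diff_derivable/d1.
have small' (a b : R) : 0 <= a <= 1 -> 0 <= b <= 1 ->
    ball u r (u + a *: (t *: dj) + b *: (t *: di)).
  by move=> a01 b01; rewrite addrAC; exact: small.
have [a [b [a01 b01 E1]]] := @second_difference _ f u (t *: di) (t *: dj)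
  (fun a b ha hb => df _ (let: conj h _ := rP _ (small a b ha hb) in h))
  (fun a b ha hb => dZ i _ (let: conj h _ := rP _ (small a b ha hb) in h)).
have [a' [b' [a01' b01' E2]]] := @second_difference _ f u (t *: dj) (t *: di)
  (fun a b ha hb => df _ (let: conj h _ := rP _ (small' a b ha hb) in h))
  (fun a b ha hb => dZ j _ (let: conj h _ := rP _ (small' a b ha hb) in h)).
have [Up Hp] := rP _ (small a b a01 b01).
have [Uq Hq] := rP _ (small' a' b' a01' b01').
exists (u + a' *: (t *: dj) + b' *: (t *: di)).
exists (u + a *: (t *: di) + b *: (t *: dj)); split; [exact: Hq|exact: Hp|].
apply: (@mulfI _ (t * t)); first by rewrite mulf_neq0 ?gt_eqF.
apply: etrans (esym (DDZ i j _ Uq)) _; apply: etrans _ (DDZ j i _ Up).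
rewrite -E1 -E2 (addrAC u (t *: dj)).
by rewrite !opprB addrACA [RHS]addrACA [X in _ = _ + X]addrC.
Unshelve. all: by end_near. Qed.

(** Expanding in coordinates, the second-order terms are symmetric in [X] and
    [Y] and cancel; the first-order terms that remain form the bracket. *)
Lemma bracket_commutator m (U : set 'rV[R]_m) (h : 'rV[R]_m -> R^o)
    (X Y : 'rV[R]_m -> 'rV[R]_m) u :
  open U -> U u -> smooth U h -> smooth U X -> smooth U Y ->
  'D_(X u) (fun q => 'D_(Y q) h q) u - 'D_(Y u) (fun q => 'D_(X q) h q) u =
  'D_('D_(X u) Y u - 'D_(Y u) X u) h u.
Proof.
move=> oU Uu sh sX sY.
have dh q : U q -> differentiable h q by have [+ _] := sh 1%N; exact.
have dD i q : U q -> differentiable ('D_(delta_mx 0 i) h) q.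
  by have [_ /(_ i)[+ _]] := sh 2%N; exact.
have dX : differentiable X u by have [+ _] := sX 1%N; exact.
have dY : differentiable Y u by have [+ _] := sY 1%N; exact.
have key (v : 'rV[R]_m) (Z : 'rV[R]_m -> 'rV[R]_m) : differentiable Z u ->
    'D_v (fun q => 'D_(Z q) h q) u = 'D_('D_v Z u) h u +
      \sum_i \sum_j v 0 j * Z u 0 i * 'D_(delta_mx 0 j) ('D_(delta_mx 0 i) h) u.
  move=> dZ; have dZi i : differentiable (fun q => Z q 0 i : R^o) u.
    by move/differentiable_mxP: dZ.
  rewrite (@near_eq_derive _ _ _ _
    (\sum_i (fun q => Z q 0 i : R^o) * ('D_(delta_mx 0 i) h))); last first.
    apply: filterS (open_nbhs_nbhs (conj oU Uu)) => q Uq.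
    by rewrite fct_sumE derive_coordE //; exact: dh.
  rewrite derive_sum; last first.
    by move=> i; exact: diff_derivable (differentiableM (dZi i) (dD i u Uu)).
  rewrite [X in _ = X + _](derive_coordE _ (dh u Uu)) -big_split /=.
  apply: eq_bigr => i _.
  have hZ : derivable (fun q => Z q 0 i : R^o) u v by exact: diff_derivable (dZi i).
  have hD : derivable ('D_(delta_mx 0 i) h) u v by exact: diff_derivable (dD i u Uu).
  rewrite [LHS](deriveM hZ hD) [LHS]addrC; congr (_ + _).
    by rewrite -(derive_entry v 0 i dZ); exact: mulrC.
  rewrite (derive_coordE v (dD i u Uu)) scaler_sumr; apply: eq_bigr => j _.
  by rewrite scalerA [X in X *: _]mulrC.
rewrite !key // opprD addrACA.
have -> : \sum_i \sum_j X u 0 j * Y u 0 i *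
      'D_(delta_mx 0 j) ('D_(delta_mx 0 i) h) u =
    \sum_i \sum_j Y u 0 j * X u 0 i *
      'D_(delta_mx 0 j) ('D_(delta_mx 0 i) h) u.
  rewrite exchange_big; apply: eq_bigr => i _; apply: eq_bigr => j _.
  by rewrite [X in X * _]mulrC (clairaut _ _ oU Uu (sh 3%N)).
rewrite [X in _ + X = _]subrr addr0 !(deriveE _ (dh u Uu)).
exact/esym/linearB.
Qed.
End Clairaut.

(** * Charts, tangent vectors and vector fields *)

Lemma kdiff_scale (R : realType) m p q k (U : set 'rV[R]_m)
    (s : 'rV[R]_m -> R^o) (F : 'rV[R]_m -> 'M[R]_(p, q)) :
  open U -> kdiff k U s -> kdiff k U F -> kdiff k U (fun u => s u *: F u).
Proof.
move=> oU ks /(kdiff_mxP _ _ oU) kF; apply/kdiff_mxP => // i j.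
by apply: kdiff_ext (kdiffM oU ks (kF i j)) => // u _; rewrite [RHS]mxE.
Qed.

Section Charts.
Variables (R : realType) (m : nat) (M : manifold R m).
Implicit Types (c d e : chart R m M) (p q : M) (W : set M).

Lemma chart_invK c p : atlas c -> chart_dom c p -> chart_inv c (chart_map c p) = p.
Proof. by move=> /atlas_chart[_ _ cK _ _] /cK. Qed.

Lemma chart_dom_open c : atlas c -> open (chart_dom c).
Proof. by move=> /atlas_chart[]. Qed.

(** A neighbourhood of [chart_map c p] is sent back into [W] by the inverse
    chart, which is continuous there. *)
Lemma chart_image_open c W : atlas c -> open W ->
  open (chart_map c @` (W `&` chart_dom c)).
Proof.
move=> /atlas_chart[odom oim cK _ ci] oW; rewrite openE => _ [p [Wp cp] <-].
have W1 : \forall v \near chart_map c p, (chart_map c @` chart_dom c) v.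
  by apply: open_nbhs_nbhs; split => //; exists p.
have W2 : \forall v \near chart_map c p, W (chart_inv c v).
  by apply: ci => //; rewrite cK //; exact: open_nbhs_nbhs.
apply: (filterS _ (filterI W1 W2)) => v /= [[q cq <-] Wq].
by exists q => //; split => //; rewrite -(cK q).
Qed.

Lemma chart_image_openW c W : atlas c -> open W -> W `<=` chart_dom c ->
  open (chart_map c @` W).
Proof. by move=> ac oW /setIidl <-; exact: chart_image_open. Qed.

Lemma chart_preimage_open c (O : set 'rV[R]_m) : atlas c -> open O ->
  open (chart_dom c `&` chart_map c @^-1` O).
Proof.
move=> /atlas_chart[odom oim cK cm ci] oO; rewrite openE => p [cp Op].
apply: filterI; first exact: open_nbhs_nbhs.
by apply: (cm p cp); exact: open_nbhs_nbhs.
Qed.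

Lemma transitionE c d p : atlas c -> chart_dom c p ->
  transition c d (chart_map c p) = chart_map d p.
Proof. by move=> ac cp; rewrite /transition /= chart_invK. Qed.

Lemma transition_differentiable c d p : chart_at p c -> chart_at p d ->
  differentiable (transition c d) (chart_map c p).
Proof.
move=> [ac cp] [ad dp]; have [df _] := atlas_compatible ac ad 1%N.
by apply: df; exists p.
Qed.

Lemma near_chart c W p : chart_at p c -> open W -> W p ->
  \forall u \near chart_map c p, exists q, [/\ W q, chart_dom c q & u = chart_map c q].
Proof.
move=> [ac cp] oW Wp.
have : nbhs (chart_map c p) (chart_map c @` (W `&` chart_dom c)).
  apply: open_nbhs_nbhs; split; first exact: chart_image_open.
  by exists p.
by apply: filterS => _ [q [Wq cq] <-]; exists q.
Qed.

Lemma diff_transition_id c p w : chart_at p c ->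
  'd (transition c c) (chart_map c p) w = w.
Proof.
move=> cpc; have df := transition_differentiable cpc cpc.
transitivity ('d (id : 'rV[R]_m -> 'rV[R]_m) (chart_map c p) w); last by rewrite diff_val.
apply: (near_eq_diff _ _ df).
apply: filterS (near_chart cpc openT I) => _ [q [_ cq ->]].
by rewrite transitionE //; case: cpc.
Qed.

(** The cocycle rule, which makes the components of a tangent vector in
    different charts consistent. *)
Lemma diff_transition_comp c d e p w : chart_at p c -> chart_at p d -> chart_at p e ->
  'd (transition c e) (chart_map c p) w =
  'd (transition d e) (chart_map d p) ('d (transition c d) (chart_map c p) w).
Proof.
move=> cp dp ep; have [[ac cpc] [ad dpd]] := (cp, dp).
have d1 := transition_differentiable cp dp.
have d2 := transition_differentiable dp ep.
rewrite -(transitionE d ac cpc) in d2 *.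
rewrite -[RHS]/((_ \o _) w) -(diff_comp d1 d2).
apply: near_eq_diff; last exact: transition_differentiable.
apply: filterS (near_chart cp (chart_dom_open ad) dpd) => _ [q [dq cq ->]].
by rewrite /= !transitionE.
Qed.

Lemma TM_diff c d p v : TM p v -> chart_at p c -> chart_at p d ->
  v d = 'd (transition c d) (chart_map c p) (v c).
Proof. by case=> _; apply. Qed.

Lemma TM_inj c p v w : chart_at p c -> TM p v -> TM p w -> v c = w c -> v = w.
Proof.
move=> cp Tv Tw vw; apply/funext => d.
have [dp|dp] := pselect (chart_at p d).
  by rewrite (TM_diff Tv cp dp) (TM_diff Tw cp dp) vw.
by rewrite (proj1 Tv) // (proj1 Tw).
Qed.

Lemma TM_lin p a v w : TM p v -> TM p w -> TM p (a *: v + w).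
Proof.
move=> Tv Tw; split => [c cp|c d cp dp].
  rewrite -[LHS]/(a *: v c + w c).
  by rewrite (proj1 Tv) // (proj1 Tw) // scaler0 addr0.
rewrite -[LHS]/(a *: v d + w d) -[(a *: v + w) c]/(a *: v c + w c).
by rewrite linearP (TM_diff Tv cp dp) (TM_diff Tw cp dp).
Qed.

Lemma TM0 p : TM p (0 : tvec M).
Proof. by split=> [//|c d cp dp]; rewrite -[RHS]/('d _ _ 0) linear0. Qed.

Lemma TMD p v w : TM p v -> TM p w -> TM p (v + w).
Proof. by move=> Tv Tw; rewrite -[v]scale1r; exact: TM_lin. Qed.

Lemma TMB p v w : TM p v -> TM p w -> TM p (v - w).
Proof. by move=> Tv Tw; rewrite -scaleN1r addrC; exact: TM_lin. Qed.

Lemma tvec_of_chart c p w : chart_at p c -> tvec_of c p w c = w.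
Proof. by move=> cp; rewrite /tvec_of asboolT // diff_transition_id. Qed.

Lemma TM_tvec_of c p w : chart_at p c -> TM p (tvec_of c p w).
Proof.
move=> cp; split=> [d dp|d e dp ep]; first by rewrite /tvec_of asboolF.
by rewrite /tvec_of (asboolT dp) (asboolT ep); exact: diff_transition_comp.
Qed.

Lemma tvec_of_components c p v : chart_at p c -> TM p v -> v = tvec_of c p (v c).
Proof.
by move=> cp Tv; apply: (TM_inj cp Tv); rewrite ?tvec_of_chart //; exact: TM_tvec_of.
Qed.

Lemma tvec_of_lin c p a x y : chart_at p c ->
  tvec_of c p (a *: x + y) = a *: tvec_of c p x + tvec_of c p y.
Proof.
move=> cp; have T := fun x => TM_tvec_of x cp.
apply: (TM_inj cp (T _) (TM_lin _ (T _) (T _))).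
by rewrite -[RHS]/(a *: tvec_of c p x c + tvec_of c p y c) !tvec_of_chart.
Qed.

Lemma tvec_of0 c p : chart_at p c -> tvec_of c p 0 = 0.
Proof.
move=> cp; apply: (TM_inj cp); [exact: TM_tvec_of|exact: TM0|].
by rewrite tvec_of_chart.
Qed.

Definition field_of c (w : 'rV[R]_m -> 'rV[R]_m) (p : M) : tvec M :=
  tvec_of c p (w (chart_map c p)).

(** In another chart [d], the components at [u] are [sum_a w_a * D_a (transition
    c d)] evaluated at [transition d c u], hence smooth as a composite of smooth
    maps. *)
Lemma field_of_vfield c w W : atlas c -> open W -> W `<=` chart_dom c ->
  smooth (chart_map c @` W) w -> vfield W (field_of c w).
Proof.
move=> ac oW Wc sw; split => // [p Wp|d ad k].
  by apply: TM_tvec_of; split => //; exact: Wc.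
pose V := chart_map c @` (W `&` chart_dom d).
pose U := chart_map d @` (W `&` chart_dom d).
have oU : open U by exact: chart_image_open.
have oWd : open (W `&` chart_dom d) by apply: openI => //; exact: chart_dom_open.
have oV : open V by apply: chart_image_openW => // p [/Wc].
(* The components of the field in [d], still as a function of the coordinates
   of [c]. *)
pose H z := \sum_a (w z 0 a : R^o) *: 'D_(delta_mx 0 a) (transition c d) z.
have kH : kdiff k V H.
  apply: kdiff_sum => // a; apply: kdiff_scale => //.
    have kw : kdiff k V w by apply: kdiff_sub (sw k) => _ [p [Wp _] <-]; exists p.
    by move/(kdiff_mxP _ _ oV): kw; apply.
  have [_ kt] := atlas_compatible ac ad k.+1.
  apply: kdiff_sub (kt a) => _ [p [Wp dp] <-]; exists p => //; split => //.
  exact: Wc.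
have kphi : kdiff k U (transition d c).
  apply: kdiff_sub (atlas_compatible ad ac k) => _ [p [Wp dp] <-].
  by exists p => //; split => //; exact: Wc.
have UV u : U u -> V (transition d c u).
  by move=> [p [Wp dp] <-]; rewrite transitionE //; exists p.
apply: kdiff_ext (kdiff_comp_mx oU oV UV kphi kH) => // _ [p [Wp dp] <-].
have cp : chart_at p c by split => //; exact: Wc.
have dpp : chart_at p d by [].
rewrite transitionE // chart_invK // /field_of /tvec_of asboolT //.
rewrite -deriveE; last exact: transition_differentiable.
by rewrite derive_coordE //; exact: transition_differentiable.
Qed.

Lemma vfield_sub W W' X : open W' -> W' `<=` W -> vfield W X -> vfield W' X.
Proof.
move=> oW' WW [oW TX sX]; split => // [p /WW/TX //|c ac k].
by apply: kdiff_sub (sX c ac k) => _ [p [Wp cp] <-]; exists p => //; split => //; exact: WW.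
Qed.

Lemma lie_bracket_TM c X Y p : chart_at p c -> TM p (lie_bracket c X Y p).
Proof. exact: TM_tvec_of. Qed.

Lemma lie_bracket_chart c X Y p : chart_at p c ->
  lie_bracket c X Y p c =
  'D_(X p c) (fun u => Y (chart_inv c u) c) (chart_map c p) -
  'D_(Y p c) (fun u => X (chart_inv c u) c) (chart_map c p).
Proof. exact: tvec_of_chart. Qed.

Lemma dirder_near_cst c p v (h : M -> R) W a : chart_at p c -> open W -> W p ->
  (forall q, W q -> h q = a) -> dirder c p v h = 0.
Proof.
move=> cp oW Wp h0; rewrite /dirder.
rewrite (@near_eq_derive _ _ _ _ (cst a)); first exact: derive_cst.
apply: filterS (near_chart cp oW Wp) => _ [q [Wq cq ->]] /=.
by rewrite chart_invK //; [exact: h0|case: cp].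
Qed.

Lemma dirder_near_eq c p v (h h' : M -> R) W : chart_at p c -> open W -> W p ->
  (forall q, W q -> h q = h' q) -> dirder c p v h = dirder c p v h'.
Proof.
move=> cp oW Wp hh; rewrite /dirder; apply: near_eq_derive.
apply: filterS (near_chart cp oW Wp) => _ [q [Wq cq ->]] /=.
by rewrite chart_invK //; [exact: hh|case: cp].
Qed.

End Charts.

(** * Bi-Lagrangian structures in adapted coordinates *)

(** [f] is not declared as a linear map, since it is obtained by fixing
    arguments of a form that is linear on tangent vectors only. *)
Lemma linear_form_coords (R : realType) n (f : 'rV[R]_n -> R) :
  (forall (t : R) x y, f (t *: x + y) = t * f x + f y) ->
  forall x, f x = \sum_i x 0 i * f (delta_mx 0 i).
Proof.
move=> fl x; pose L : {linear 'rV[R]_n -> R^o} :=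
  HB.pack (f : 'rV[R]_n -> R^o) (GRing.isLinear.Build _ _ _ _ _ fl).
rewrite -[LHS]/(L x) {1}[x]row_sum_delta linear_sum.
by apply: eq_bigr => i _; rewrite linearZ.
Qed.

Lemma bilinear_form_sum (R : realType) m n (a : 'rV[R]_m) (P : 'M[R]_(m, n)) (b : 'rV[R]_n) :
  (a *m P *m b^T) 0 0 = \sum_i a 0 i * \sum_j b 0 j * P i j.
Proof.
rewrite -mulmxA mxE; apply: eq_bigr => i _; rewrite mxE; congr (_ * _).
by apply: eq_bigr => j _; rewrite mxE mulrC.
Qed.

Lemma bilinear_form_inj (R : realType) m n (P Q : 'M[R]_(m, n)) :
  (forall (a : 'rV[R]_m) (b : 'rV[R]_n), (a *m P *m b^T) 0 0 = (a *m Q *m b^T) 0 0) ->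
  P = Q.
Proof.
move=> PQ; apply/matrixP => i j.
have := PQ (delta_mx 0 i) (delta_mx 0 j).
by rewrite -!rowE !trmx_delta -!colE !mxE.
Qed.

Lemma form_row_inj (R : realType) n (x y : 'rV[R]_n) :
  (forall b : 'rV[R]_n, (x *m b^T) 0 0 = (y *m b^T) 0 0) -> x = y.
Proof.
move=> xy; apply/rowP => j; have := xy (delta_mx 0 j).
by rewrite trmx_delta -!colE !mxE.
Qed.

Lemma form_col_inj (R : realType) n (x y : 'cV[R]_n) :
  (forall a : 'rV[R]_n, (a *m x) 0 0 = (a *m y) 0 0) -> x = y.
Proof.
move=> xy; apply/colP => j; have := xy (delta_mx 0 j).
by rewrite -!rowE !mxE.
Qed.

Lemma row_mx_delta_l (R : realType) n (i : 'I_n) :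
  row_mx (delta_mx 0 i) 0 = delta_mx 0 (lshift n i) :> 'rV[R]_(n + n).
Proof.
apply/rowP => k; rewrite -(fintype.splitK k); case: (fintype.split k) => j /=.
  by rewrite row_mxEl !mxE eq_lshift.
by rewrite row_mxEr !mxE eq_rlshift andbF.
Qed.

Lemma row_mx_delta_r (R : realType) n (i : 'I_n) :
  row_mx 0 (delta_mx 0 i) = delta_mx 0 (rshift n i) :> 'rV[R]_(n + n).
Proof.
apply/rowP => k; rewrite -(fintype.splitK k); case: (fintype.split k) => j /=.
  by rewrite row_mxEl !mxE eq_lrshift andbF.
by rewrite row_mxEr !mxE eq_rshift.
Qed.

Lemma row_mxl_lin (R : realType) n (t : R) (a b : 'rV[R]_n) :
  row_mx (t *: a + b) 0 = t *: row_mx a 0 + row_mx b 0 :> 'rV[R]_(n + n).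
Proof. by rewrite scale_row_mx add_row_mx scaler0 addr0. Qed.

Lemma row_mxr_lin (R : realType) n (t : R) (a b : 'rV[R]_n) :
  row_mx 0 (t *: a + b) = t *: row_mx 0 a + row_mx 0 b :> 'rV[R]_(n + n).
Proof. by rewrite scale_row_mx add_row_mx scaler0 addr0. Qed.

Section Bilagrangian.
Variables (R : realType) (n : nat) (M : manifold R (n + n)).
Variables (om : M -> tvec M -> tvec M -> R) (F G : foliation M).
Variable c : chart R (n + n) M.
Hypotheses (hM : bilagrangian om F G) (ac : atlas c).
Hypotheses (hF : forall p, chart_dom c p -> Tfol F p = Tx c p).
Hypotheses (hG : forall p, chart_dom c p -> Tfol G p = Ty c p).

(** The matrix [A] of the form as a function of all the coordinates [(x, y)]
    together. *)
Definition mixed_at (u : 'rV[R]_(n + n)) : 'M[R]_n :=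
  mixed_matrix om c (lsubmx u) (rsubmx u).

Let om2 := symplectic_form (bilag_symplectic hM).

Lemma TfolFE p v : chart_dom c p -> Tfol F p v <-> TM p v /\ rsubmx (v c) = 0.
Proof.
move=> cp; rewrite hF //; split=> [[Tv v0]|[Tv v0]]; split => //.
  by apply/rowP => i; rewrite !mxE; exact: v0.
by move=> i; have /rowP/(_ i) := v0; rewrite !mxE.
Qed.

Lemma TfolGE p v : chart_dom c p -> Tfol G p v <-> TM p v /\ lsubmx (v c) = 0.
Proof.
move=> cp; rewrite hG //; split=> [[Tv v0]|[Tv v0]]; split => //.
  by apply/rowP => i; rewrite !mxE; exact: v0.
by move=> i; have /rowP/(_ i) := v0; rewrite !mxE.
Qed.

Section AtPoint.
Variables (p : M) (cp : chart_dom c p).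
Let cpc : chart_at p c := conj ac cp.
Let tv x : tvec M := tvec_of c p x.
Let Ttv x : TM p (tv x) := TM_tvec_of x cpc.

Lemma om_linl (t : R) v w z : TM p v -> TM p w -> TM p z ->
  om p (t *: v + w) z = t * om p v z + om p w z.
Proof. exact: form_linear om2 p t v w z. Qed.

Lemma om_linr (t : R) v w z : TM p v -> TM p w -> TM p z ->
  om p z (t *: v + w) = t * om p z v + om p z w.
Proof.
move=> Tv Tw Tz; have anti := form_antisym om2.
rewrite (anti _ _ _ Tz (TM_lin _ Tv Tw)) om_linl // opprD -mulrN.
by rewrite -(anti _ _ _ Tz Tv) -(anti _ _ _ Tz Tw).
Qed.

Lemma om_FG a b :
  om p (tv (row_mx a 0)) (tv (row_mx 0 b)) =
  (a *m mixed_at (chart_map c p) *m b^T) 0 0.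
Proof.
rewrite bilinear_form_sum.
rewrite (linear_form_coords (f := fun a => om p (tv (row_mx a 0)) (tv (row_mx 0 b)))).
  apply: eq_bigr => i _; congr (_ * _).
  rewrite (linear_form_coords
    (f := fun b => om p (tv (row_mx (delta_mx 0 i) 0)) (tv (row_mx 0 b)))).
    apply: eq_bigr => j _; congr (_ * _).
    rewrite mxE hsubmxK chart_invK //.
    by rewrite /coord_field row_mx_delta_l row_mx_delta_r.
  by move=> t x y; rewrite row_mxr_lin /tv tvec_of_lin // om_linr.
by move=> t x y; rewrite row_mxl_lin /tv tvec_of_lin // om_linl.
Qed.

Lemma om_FF a a' : om p (tv (row_mx a 0)) (tv (row_mx a' 0)) = 0.
Proof.
have Fa x : Tfol F p (tv (row_mx x 0)).
  by apply/TfolFE => //; rewrite /tv tvec_of_chart // row_mxKr.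
by have [+ _] := bilag_lagF hM (Ttv (row_mx a 0)); apply.
Qed.

Lemma om_GG b b' : om p (tv (row_mx 0 b)) (tv (row_mx 0 b')) = 0.
Proof.
have Ga x : Tfol G p (tv (row_mx 0 x)).
  by apply/TfolGE => //; rewrite /tv tvec_of_chart // row_mxKl.
by have [+ _] := bilag_lagG hM (Ttv (row_mx 0 b)); apply.
Qed.

(** The two diagonal blocks of the form vanish because both foliations are
    Lagrangian; the two others are [A] and [- A^T]. *)
Lemma om_coords v w : TM p v -> TM p w ->
  om p v w = (lsubmx (v c) *m mixed_at (chart_map c p) *m (rsubmx (w c))^T) 0 0
           - (lsubmx (w c) *m mixed_at (chart_map c p) *m (rsubmx (v c))^T) 0 0.
Proof.
move=> Tv Tw.
have split_v x : tv x = 1 *: tv (row_mx (lsubmx x) 0) + tv (row_mx 0 (rsubmx x)).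
  by rewrite /tv -tvec_of_lin // scale1r add_row_mx addr0 add0r hsubmxK.
rewrite (tvec_of_components cpc Tv) (tvec_of_components cpc Tw) !tvec_of_chart //.
rewrite -/(tv (v c)) -/(tv (w c)) (split_v (v c)) (split_v (w c)).
have TT x : TM p (1 *: tv (row_mx (lsubmx x) 0) + tv (row_mx 0 (rsubmx x))).
  exact: TM_lin.
rewrite om_linl // !om_linr // !mul1r om_FF om_GG add0r addr0; congr (_ + _).
  exact: om_FG.
by rewrite (form_antisym om2) // om_FG.
Qed.

(** A row [a] with [a A = 0] is a vector of [TF] orthogonal to everything, since
    it is already orthogonal to [TF]. *)
Lemma mixed_unit : mixed_at (chart_map c p) \in unitmx.
Proof.
rewrite -row_free_unit; apply/inj_row_free => a aA.
suff : tv (row_mx a 0) = 0.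
  move=> /(congr1 (fun v : tvec M => v c)); rewrite /tv tvec_of_chart //.
  by rewrite -[RHS]/(0 : 'rV_(n + n)) -row_mx0 => /eq_row_mx[].
apply: (symplectic_nondeg (bilag_symplectic hM) (Ttv _)) => w Tw.
rewrite om_coords // /tv tvec_of_chart // row_mxKl row_mxKr aA.
by rewrite mul0mx trmx0 mulmx0 mxE subrr.
Qed.

End AtPoint.

Lemma om0l p w : TM p w -> om p 0 w = 0.
Proof.
move=> Tw; have := om_linl (-1) (TM0 p) (TM0 p) Tw.
by rewrite scaler0 addr0 mulN1r addNr.
Qed.

Lemma om0r p w : TM p w -> om p w 0 = 0.
Proof.
by move=> Tw; rewrite (form_antisym om2 Tw (TM0 p)) om0l ?oppr0.
Qed.

Lemma mixed_smooth : smooth (chart_map c @` chart_dom c) mixed_at.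
Proof.
have oc := chart_dom_open ac.
have oim : open (chart_map c @` chart_dom c) by exact: chart_image_openW.
move=> k; apply/kdiff_mxP => // i j.
have vf (l : 'I_(n + n)) : vfield (chart_dom c) (coord_field c l).
  by apply: (field_of_vfield (w := fun=> delta_mx 0 l)) => // k'; exact: kdiff_cst.
have := form_smooth om2 (vf (lshift n i)) (vf (rshift n j)) ac k.
rewrite setIid => ks; apply: kdiff_ext ks => // _ [p cp <-].
by rewrite /mixed_at /mixed_matrix mxE /= hsubmxK.
Qed.

Lemma section_F W w : open W -> W `<=` chart_dom c ->
  smooth (chart_map c @` W) (fun u => row_mx (w u) 0 : 'rV[R]_(n + n)) ->
  section_of F W (field_of c (fun u => row_mx (w u) 0)).
Proof.
move=> oW Wc sw; split => [|p /Wc cp]; first exact: field_of_vfield.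
have cpc : chart_at p c by [].
apply/TfolFE => //; split; first exact: TM_tvec_of.
by rewrite /field_of tvec_of_chart // row_mxKr.
Qed.

Lemma section_G W w : open W -> W `<=` chart_dom c ->
  smooth (chart_map c @` W) (fun u => row_mx 0 (w u) : 'rV[R]_(n + n)) ->
  section_of G W (field_of c (fun u => row_mx 0 (w u))).
Proof.
move=> oW Wc sw; split => [|p /Wc cp]; first exact: field_of_vfield.
have cpc : chart_at p c by [].
apply/TfolGE => //; split; first exact: TM_tvec_of.
by rewrite /field_of tvec_of_chart // row_mxKl.
Qed.

Lemma lie_bracket_field w w' p : chart_dom c p ->
  lie_bracket c (field_of c w) (field_of c w') p =
  tvec_of c p ('D_(w (chart_map c p)) w' (chart_map c p) -
               'D_(w' (chart_map c p)) w (chart_map c p)).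
Proof.
move=> cp; have cpc : chart_at p c by [].
have E z : \forall u \near chart_map c p, field_of c z (chart_inv c u) c = z u.
  apply: filterS (near_chart cpc (chart_dom_open ac) cp) => _ [q [_ cq ->]].
  by rewrite chart_invK // /field_of tvec_of_chart.
have Ep z : field_of c z p c = z (chart_map c p) by rewrite /field_of tvec_of_chart.
by rewrite /lie_bracket !Ep (near_eq_derive _ (E w')) (near_eq_derive _ (E w)).
Qed.

Variable nabla : M -> tvec M -> (M -> tvec M) -> tvec M.
Hypothesis hnabla : bilagrangian_connection om F G nabla.
Let conn := bilag_conn hnabla.

Lemma nabla0 W Y p : vfield W Y -> W p -> nabla p 0 Y = 0.
Proof.
move=> vY Wp; have := conn_linear conn 1 vY Wp (TM0 p) (TM0 p).
by rewrite scaler0 addr0 scale1r => /eqP; rewrite -subr_eq0 opprD addrA subrr sub0r oppr_eq0 => /eqP.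
Qed.

(** The two derivatives differ by the bracket, hence are equal, while one is
    tangent to [G] and the other to [F]. *)
Lemma nabla_commuting W X Y p : section_of F W X -> section_of G W Y -> W p ->
  chart_dom c p -> lie_bracket c X Y p = 0 ->
  nabla p (X p) Y = 0 /\ nabla p (Y p) X = 0.
Proof.
move=> sX sY Wp cp; have cpc : chart_at p c by [].
have [[vX FX] [vY GY]] := (sX, sY).
have TX : TM p (X p) by case: vX => _ + _; exact.
have TY : TM p (Y p) by case: vY => _ + _; exact.
rewrite -(bilag_conn_torsion hnabla sX sY Wp cpc) => /eqP; rewrite subr_eq0 => /eqP E.
have /(TfolGE _ cp)[TN l0] := bilag_conn_G hnabla sY Wp TX.
have /(TfolFE _ cp)[_ r0] := bilag_conn_F hnabla sX Wp TY.
suff N0 : nabla p (X p) Y = 0 by rewrite -E.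
apply: (TM_inj cpc TN (TM0 p)).
by rewrite -[LHS]hsubmxK l0 E r0 row_mx0.
Qed.

End Bilagrangian.

(** * The factorization as an integrability condition *)

Section Boxes.
Variable R : realType.

Lemma ball_row_mx n (r : R) (x y : 'rV[R]_n) :
  ball 0 r (row_mx x y) <-> ball 0 r x /\ ball 0 r y.
Proof.
split=> [[r0 xy]|[[r0 xr] [_ yr]]].
  split; split => // i j.
    by have := xy i (lshift n j); rewrite row_mxEl !mxE.
  by have := xy i (rshift n j); rewrite row_mxEr !mxE.
split => // i j; rewrite -(fintype.splitK j); case: (fintype.split j) => l /=.
  by have := xr i l; rewrite row_mxEl !mxE.
by have := yr i l; rewrite row_mxEr !mxE.
Qed.

Lemma ball0_scale (V : normedModType R) (r s : R) (x : V) :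
  0 <= s <= 1 -> ball 0 r x -> ball 0 r (s *: x).
Proof.
move=> /andP[s0 s1]; rewrite -ball_normE /= !sub0r !normrN normrZ ger0_norm //.
by apply: le_lt_trans; rewrite ler_piMl.
Qed.

Lemma kdiff_lsubmx n k (U : set 'rV[R]_(n + n)) : open U ->
  kdiff k U (lsubmx : _ -> 'rV[R]_n).
Proof.
move=> oU; exact: (kdiff_lin_comp (L := lsubmx) oU (@continuous_lsubmx _ _ _ _) (kdiff_id k U)).
Qed.

Lemma kdiff_rsubmx n k (U : set 'rV[R]_(n + n)) : open U ->
  kdiff k U (rsubmx : _ -> 'rV[R]_n).
Proof.
move=> oU; exact: (kdiff_lin_comp (L := rsubmx) oU (@continuous_rsubmx _ _ _ _) (kdiff_id k U)).
Qed.

Lemma derive_eq0_cst_mx (V : normedModType R) p q (P : V -> 'M[R]_(p, q)) (u v : V) :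
  (forall s : R, 0 <= s <= 1 -> differentiable P (u + s *: v)) ->
  (forall s : R, 0 <= s <= 1 -> 'D_v P (u + s *: v) = 0) ->
  P (u + v) = P u.
Proof.
move=> dP DP; apply/matrixP => i j.
apply: (@derive_eq0_cst _ _ (fun u => P u i j : R^o)) => s s01.
  by move/differentiable_mxP: (dP s s01).
by rewrite derive_entry ?DP ?mxE //; exact: dP.
Qed.

End Boxes.

Lemma smooth_differentiable_derive (R : realType) m (W : normedModType R)
    (U : set 'rV[R]_m) (P : 'rV[R]_m -> W) v u :
  open U -> smooth U P -> U u -> differentiable ('D_v P) u.
Proof.
move=> oU sP Uu.
apply: (@near_eq_differentiable _ _ _ (fun u => \sum_i v 0 i *: 'D_(delta_mx 0 i) P u)).
  apply: filterS (open_nbhs_nbhs (conj oU Uu)) => w Uw.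
  by rewrite derive_coordE //; have [+ _] := sP 1%N; apply.
have -> : (fun u => \sum_i v 0 i *: 'D_(delta_mx 0 i) P u) =
    \sum_i (v 0 i \*: 'D_(delta_mx 0 i) P).
  by apply/funext => w; rewrite fct_sumE.
apply: differentiable_sum => i; apply: differentiableZ.
by have [_ /(_ i)[+ _]] := sP 2%N; apply.
Qed.

Section Invmx.
Variables (R : realType) (m p : nat) (U : set 'rV[R]_m) (P : 'rV[R]_m -> 'M[R]_p).
Hypotheses (oU : open U) (uP : forall u, U u -> P u \in unitmx) (sP : smooth U P).

Lemma differentiable_invmx u : U u -> differentiable (fun u => invmx (P u)) u.
Proof.
by move=> Uu; have [+ _] := kdiff_invmx oU uP (sP 1%N); apply.
Qed.

(** Differentiate [P * P^-1 = 1]. *)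
Lemma derive_invmx u v : U u ->
  'D_v (fun u => invmx (P u)) u = - (invmx (P u) *m 'D_v P u *m invmx (P u)).
Proof.
move=> Uu; have dP : differentiable P u by have [+ _] := sP 1%N; apply.
have E : 'D_v (fun u => P u *m invmx (P u)) u = 0.
  rewrite (@near_eq_derive _ _ _ _ (cst 1%:M)); first exact: derive_cst.
  apply: filterS (open_nbhs_nbhs (conj oU Uu)) => w Uw /=.
  by rewrite mulmxV // uP.
rewrite (derive_mulmx v dP (differentiable_invmx Uu)) in E.
move/(congr1 (mulmx (invmx (P u)))): E.
rewrite mulmxDr mulmx0 (mulmxA _ (P u)) mulVmx ?uP // mul1mx.
by rewrite mulmxA addrC => /eqP; rewrite addr_eq0 => /eqP.
Qed.

End Invmx.

Section Factorization.
Variables (R : realType) (n : nat) (r : R) (P : 'rV[R]_(n + n) -> 'M[R]_n).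
Let O : set 'rV[R]_(n + n) := ball 0 r.
Hypotheses (r0 : 0 < r) (sP : smooth O P) (uP : forall u, O u -> P u \in unitmx).
Hypothesis mixed_eq : forall (a b : 'rV[R]_n) u, O u ->
  'D_(row_mx 0 b) ('D_(row_mx a 0) P) u =
  'D_(row_mx a 0) P u *m invmx (P u) *m 'D_(row_mx 0 b) P u.

Let oO : open O. Proof. exact: ball_open. Qed.

Let dP u : O u -> differentiable P u. Proof. by have [+ _] := sP 1%N; apply. Qed.

Let dDP v u : O u -> differentiable ('D_v P) u.
Proof. exact: smooth_differentiable_derive. Qed.

(** In coordinates, the connection matrix along the first foliation. *)
Definition log_derivative (a : 'rV[R]_n) u := 'D_(row_mx a 0) P u *m invmx (P u).

(** [D_b (D_a P * P^-1) = D_b D_a P * P^-1 - D_a P * P^-1 * D_b P * P^-1], which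
    vanishes by the mixed equation. *)
Lemma log_derivative_cst a x y : O (row_mx x y) ->
  log_derivative a (row_mx x y) = log_derivative a (row_mx x 0).
Proof.
move=> /ball_row_mx[xr yr].
have path (s : R) : 0 <= s <= 1 -> O (row_mx x 0 + s *: row_mx 0 y).
  move=> s01; rewrite scale_row_mx scaler0 add_row_mx addr0 add0r.
  by apply/ball_row_mx; split => //; exact: ball0_scale.
have dI u : O u -> differentiable (fun u => invmx (P u)) u.
  exact: differentiable_invmx.
have -> : row_mx x y = row_mx x 0 + row_mx 0 y by rewrite add_row_mx addr0 add0r.
apply: derive_eq0_cst_mx => s /path Os.
  exact: (differentiable_mulmx (dDP _ Os) (dI _ Os)).
rewrite (derive_mulmx _ (dDP _ Os) (dI _ Os)) mixed_eq //.
by rewrite (derive_invmx oO uP sP) // mulmxN !mulmxA subrr.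
Qed.

(** The function [P (x, 0)^-1 P (x, y)] does not depend on [x], because [P (x,
    y)] and [P (x, 0)] have the same logarithmic derivative in the [x]
    directions; compare its values at [x] and at [0]. *)
Lemma mixed_eq_factor x y : O (row_mx x y) ->
  P (row_mx x y) = P (row_mx x 0) *m (invmx (P 0) *m P (row_mx 0 y)).
Proof.
move=> Oxy; have [xr yr] := (ball_row_mx r x y).1 Oxy.
(* [pi] is the projection onto the [x] directions, so [P \o pi] is [P (x, 0)]. *)
pose pi (u : 'rV[R]_(n + n)) : 'rV[R]_(n + n) := row_mx (lsubmx u) 0.
have Opi u : O u -> O (pi u).
  by rewrite -{1}[u]hsubmxK => /ball_row_mx[ul _]; apply/ball_row_mx; split => //; exact: ballxx.
have kpi k : kdiff k O pi.
  by apply: kdiff_row_mx => //; [exact: kdiff_lsubmx | exact: kdiff_cst].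
have sPpi : smooth O (P \o pi).
  by move=> k; apply: (kdiff_comp_mx oO oO Opi (kpi k) (sP k)).
have uPpi u : O u -> (P \o pi) u \in unitmx by move=> /Opi /uP.
have DPpi a u : 'D_(row_mx a 0) (P \o pi) u = 'D_(row_mx a 0) P (pi u).
  rewrite /derive.
  have -> // : (fun h : R => h^-1 *: (((P \o pi) \o shift u) (h *: row_mx a 0) - (P \o pi) u))
    = (fun h : R => h^-1 *: ((P \o shift (pi u)) (h *: row_mx a 0) - P (pi u))).
  apply/funext => h /=; congr (_ *: (P _ - _)).
  by rewrite /pi -{1}[u]hsubmxK scale_row_mx add_row_mx row_mxKl scaler0 add_row_mx addr0.
pose Q u := invmx ((P \o pi) u) *m P u.
have dI u : O u -> differentiable (fun u => invmx ((P \o pi) u)) u.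
  exact: (differentiable_invmx oO uPpi sPpi).
have path (s : R) : 0 <= s <= 1 -> O (row_mx 0 y + s *: row_mx x 0).
  move=> s01; rewrite scale_row_mx scaler0 add_row_mx addr0 add0r.
  by apply/ball_row_mx; split => //; exact: ball0_scale.
have QE : Q (row_mx x y) = Q (row_mx 0 y).
  have -> : row_mx x y = row_mx 0 y + row_mx x 0 by rewrite add_row_mx addr0 add0r.
  apply: derive_eq0_cst_mx => s /path Os.
    exact: (differentiable_mulmx (dI _ Os) (dP Os)).
  rewrite (derive_mulmx _ (dI _ Os) (dP Os)).
  rewrite (derive_invmx oO uPpi sPpi) // DPpi /= mulNmx.
  set u := row_mx 0 y + s *: row_mx x 0 in Os *.
  have := log_derivative_cst x (x := lsubmx u) (y := rsubmx u).
  rewrite hsubmxK => /(_ Os) /esym E.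
  rewrite -/(pi u) in E.
  have -> : 'D_(row_mx x 0) P u = log_derivative x u *m P u.
    by rewrite /log_derivative mulmxKV // uP.
  by rewrite -E /log_derivative -!mulmxA addNr.
have Q0 : Q (row_mx 0 y) = invmx (P 0) *m P (row_mx 0 y).
  by rewrite /Q /= /pi row_mxKl row_mx0.
rewrite -Q0 -QE /Q /= /pi row_mxKl mulKVmx // uP //.
by apply/ball_row_mx; split => //; exact: ballxx.
Qed.

End Factorization.

(** * Flatness gives the mixed second-order equation *)

Section Forward.
Variables (R : realType) (n : nat) (M : manifold R (n + n)).
Variables (om : M -> tvec M -> tvec M -> R) (F G : foliation M).
Variable c : chart R (n + n) M.
Hypotheses (hM : bilagrangian om F G) (ac : atlas c).
Hypotheses (hF : forall p, chart_dom c p -> Tfol F p = Tx c p).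
Hypotheses (hG : forall p, chart_dom c p -> Tfol G p = Ty c p).
Variable nabla : M -> tvec M -> (M -> tvec M) -> tvec M.
Hypothesis hnabla : bilagrangian_connection om F G nabla.
Let conn := bilag_conn hnabla.
Let A := mixed_at om c.
Let W := chart_dom c.
Let oW : open W := chart_dom_open ac.

(** A field that vanishes on an open set is there its own double. *)
Lemma nabla_zero_field W' Z p v : vfield W' Z -> (forall q, W' q -> Z q = 0) ->
  W' p -> TM p v -> nabla p v Z = 0.
Proof.
move=> vZ Z0 Wp Tv.
have vZZ : vfield W' (fun q => Z q + Z q).
  have [oW' TZ sZ] := vZ; split => // [q Wq|d ad k]; first by apply: TMD; exact: TZ.
  by apply: kdiffD; [exact: chart_image_open|exact: sZ|exact: sZ].
have E : nabla p v Z = nabla p v Z + nabla p v Z.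
  rewrite -(conn_add conn vZ vZ Wp Tv); apply: (conn_local conn vZ vZZ) => // q Wq.
  by rewrite Z0 // addr0.
by apply: (@addrI _ (nabla p v Z)); rewrite addr0 -E.
Qed.

Lemma dirder_bilinear (a b : 'rV[R]_n) p v (P : 'rV[R]_(n + n) -> 'M[R]_n) :
  chart_dom c p -> differentiable P (chart_map c p) ->
  dirder c p v (fun q => (a *m P (chart_map c q) *m b^T) 0 0) =
  (a *m 'D_(v c) P (chart_map c p) *m b^T) 0 0.
Proof.
move=> cp dP; have cpc : chart_at p c by [].
rewrite /dirder.
rewrite (@near_eq_derive _ _ _ _ (fun u => (a *m P u *m b^T) 0 0 : R^o)); last first.
  apply: filterS (near_chart cpc oW cp) => _ [q [_ cq ->]] /=.
  by rewrite chart_invK.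
have da : differentiable (cst a : _ -> 'rV[R]_n) (chart_map c p) by exact: differentiable_cst.
have db : differentiable (cst b^T : _ -> 'cV[R]_n) (chart_map c p) by exact: differentiable_cst.
have daP := differentiable_mulmx da dP.
rewrite (derive_entry _ _ _ (differentiable_mulmx daP db)).
rewrite (derive_mulmx _ daP db) (derive_mulmx _ da dP) !derive_cst.
by rewrite mul0mx mulmx0 add0r addr0.
Qed.

(** Fields with constant components: with arbitrary rows [a] and [b] in place of
    basis vectors, identities between matrices can be tested without indices. *)
Definition constF (a : 'rV[R]_n) := field_of c (fun _ => row_mx a 0 : 'rV[R]_(n + n)).
Definition constG (b : 'rV[R]_n) := field_of c (fun _ => row_mx 0 b : 'rV[R]_(n + n)).

Lemma constF_section a : section_of F W (constF a).
Proof. by apply: (section_F ac hF (w := fun=> a)) => // k; exact: kdiff_cst. Qed.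

Lemma constG_section b : section_of G W (constG b).
Proof. by apply: (section_G ac hG (w := fun=> b)) => // k; exact: kdiff_cst. Qed.

Section At.
Variables (p : M) (cp : W p).
Let cpc : chart_at p c := conj ac cp.

Let TF a : TM p (constF a p). Proof. exact: TM_tvec_of. Qed.
Let TG b : TM p (constG b p). Proof. exact: TM_tvec_of. Qed.

Lemma constF_chart a : constF a p c = row_mx a 0.
Proof. exact: tvec_of_chart. Qed.

Lemma constG_chart b : constG b p c = row_mx 0 b.
Proof. exact: tvec_of_chart. Qed.

Lemma om_const a b :
  om p (constF a p) (constG b p) = (a *m A (chart_map c p) *m b^T) 0 0.
Proof. exact: (om_FG hM ac cp). Qed.

Lemma bracket_const a b : lie_bracket c (constF a) (constG b) p = 0.
Proof.
by rewrite lie_bracket_field // !derive_cst subrr tvec_of0.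
Qed.

Lemma nabla_FG a b : nabla p (constF a p) (constG b) = 0.
Proof.
by have [] := nabla_commuting ac hF hG hnabla (constF_section a)
  (constG_section b) cp cp (bracket_const a b).
Qed.

Lemma nabla_GF a b : nabla p (constG b p) (constF a) = 0.
Proof.
by have [] := nabla_commuting ac hF hG hnabla (constF_section a)
  (constG_section b) cp cp (bracket_const a b).
Qed.

End At.

Let dA p : W p -> differentiable A (chart_map c p).
Proof.
by move=> cp; have [dA _] := mixed_smooth hM ac 1%N; apply: dA; exists p.
Qed.

(** Differentiate [om (constF a) (constG b)] along [constF a'], along which
    [constG b] is parallel. *)
Lemma om_nabla_FF p a' a b : W p ->
  om p (nabla p (constF a' p) (constF a)) (constG b p) =
  (a *m 'D_(row_mx a' 0) A (chart_map c p) *m b^T) 0 0.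
Proof.
move=> cp; have cpc : chart_at p c by [].
have TF : TM p (constF a' p) by exact: TM_tvec_of.
have := bilag_conn_om hnabla (proj1 (constF_section a)) (proj1 (constG_section b)) cp TF cpc.
rewrite (nabla_FG cp) (om0r hM) ?addr0; last exact: TM_tvec_of.
move=> <-; rewrite -(constF_chart cp a') -dirder_bilinear //; last exact: dA.
by apply: (dirder_near_eq _ cpc oW cp) => q cq; rewrite om_const.
Qed.

(** Differentiate [om (constF a) (constG b)] along [constG b'], along which
    [constF a] is parallel. *)
Lemma om_nabla_GG p b' a b : W p ->
  om p (constF a p) (nabla p (constG b' p) (constG b)) =
  (a *m 'D_(row_mx 0 b') A (chart_map c p) *m b^T) 0 0.
Proof.
move=> cp; have cpc : chart_at p c by [].
have TG : TM p (constG b' p) by exact: TM_tvec_of.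
have := bilag_conn_om hnabla (proj1 (constF_section a)) (proj1 (constG_section b)) cp TG cpc.
rewrite (nabla_GF cp) (om0l hM) ?add0r; last exact: TM_tvec_of.
move=> <-; rewrite -(constG_chart cp b') -dirder_bilinear //; last exact: dA.
by apply: (dirder_near_eq _ cpc oW cp) => q cq; rewrite om_const.
Qed.

(** In the curvature of [constF a'], [constG b'] applied to [constF a], only
    [nabla_(b') (nabla_(a') (constF a))] survives.  Its pairing with [constG b]
    is [D_b' D_a' A] minus the pairing of [nabla_(a') (constF a)] with
    [nabla_(b') (constG b)], and the latter is [D_a' A * A^-1 * D_b' A]. *)
Lemma flat_mixed_eq (U : set M) p a' b' : flat_on nabla U -> U p -> W p ->
  'D_(row_mx 0 b') ('D_(row_mx a' 0) A) (chart_map c p) =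
  'D_(row_mx a' 0) A (chart_map c p) *m invmx (A (chart_map c p)) *m
    'D_(row_mx 0 b') A (chart_map c p).
Proof.
move=> flat Up cp; have cpc : chart_at p c by [].
apply: bilinear_form_inj => a b.
have [[vF _] [vF' _]] := (constF_section a, constF_section a').
have [[vG _] [vG' _]] := (constG_section b, constG_section b').
have TF x : TM p (constF x p) by exact: TM_tvec_of.
have TG x : TM p (constG x p) by exact: TM_tvec_of.
pose Z1 q := nabla q (constG b' q) (constF a).
pose Z2 q := nabla q (constF a' q) (constF a).
have vZ1 : vfield W Z1 by exact: (conn_smooth conn vG' vF).
have vZ2 : vfield W Z2 by exact: (conn_smooth conn vF' vF).
(* [Z1] vanishes identically and so does the bracket of the two constant fields. *)
have T2 : nabla p (constG b' p) Z2 = 0.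
  have := flat W (constF a') (constG b') (constF a) p c vF' vG' vF Up cp cpc.
  rewrite /curvature bracket_const // (nabla0 hnabla vF cp) subr0.
  rewrite (nabla_zero_field vZ1) // ?sub0r; last by move=> q cq; exact: nabla_GF.
  by move/eqP; rewrite oppr_eq0 => /eqP.
have := bilag_conn_om hnabla vZ2 vG cp (TG b') cpc.
rewrite T2 (om0l hM) // add0r.
rewrite (@dirder_near_eq _ _ _ _ _ _ _
  (fun q => (a *m 'D_(row_mx a' 0) A (chart_map c q) *m b^T) 0 0) W) //; last first.
  by move=> q cq; exact: om_nabla_FF.
rewrite (@dirder_bilinear a b p (constG b' p) ('D_(row_mx a' 0) A)) //
  ?constG_chart //; last first.
  apply: (smooth_differentiable_derive _ _ (mixed_smooth hM ac)); last by exists p.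
  exact: chart_image_openW.
move=> ->.
set u := chart_map c p.
have uA : A u \in unitmx by exact: (mixed_unit hM ac hF hG cp).
set N := nabla p (constG b' p) (constG b).
have /(TfolGE hG _ cp)[TN lN] : Tfol G p N.
  exact: (bilag_conn_G hnabla (constG_section b) cp (TG b')).
have /(TfolFE hF _ cp)[TZ rZ] : Tfol F p (Z2 p).
  exact: (bilag_conn_F hnabla (constF_section a) cp (TF a')).
have NE : A u *m (rsubmx (N c))^T = 'D_(row_mx 0 b') A u *m b^T.
  apply: form_col_inj => x; have := om_nabla_GG b' x b cp.
  rewrite (om_coords hM ac hF hG cp) // constF_chart // row_mxKl row_mxKr lN.
  by rewrite !mul0mx [X in _ - X]mxE subr0 -!mulmxA.
have ZE : lsubmx (Z2 p c) *m A u = a *m 'D_(row_mx a' 0) A u.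
  apply: form_row_inj => x; have := om_nabla_FF a' a x cp.
  rewrite -/(Z2 p) (om_coords hM ac hF hG cp) // constG_chart // row_mxKl row_mxKr rZ.
  by rewrite trmx0 mulmx0 [X in _ - X]mxE subr0.
rewrite (om_coords hM ac hF hG cp) // lN rZ trmx0 mulmx0.
rewrite [X in _ - X]mxE subr0 -/u -/A.
by rewrite !mulmxA -ZE mulmxK // -[in RHS]mulmxA -NE mulmxA.
Qed.

End Forward.

(** * A factorization gives a parallel frame *)

Section Backward.
Variables (R : realType) (n : nat) (M : manifold R (n + n)).
Variables (om : M -> tvec M -> tvec M -> R) (F G : foliation M).
Variable c : chart R (n + n) M.
Hypotheses (hM : bilagrangian om F G) (ac : atlas c).
Hypotheses (hF : forall p, chart_dom c p -> Tfol F p = Tx c p).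
Hypotheses (hG : forall p, chart_dom c p -> Tfol G p = Ty c p).
Variable nabla : M -> tvec M -> (M -> tvec M) -> tvec M.
Hypothesis hnabla : bilagrangian_connection om F G nabla.
Let conn := bilag_conn hnabla.
Let A := mixed_at om c.

Lemma om_parallel W E Z p v d : vfield W E -> vfield W Z ->
  (forall q v, W q -> TM q v -> nabla q v E = 0) ->
  W p -> TM p v -> chart_at p d ->
  om p (nabla p v Z) (E p) = dirder d p v (fun q => om q (Z q) (E q)).
Proof.
move=> vE vZ par Wp Tv dp.
rewrite (bilag_conn_om hnabla vZ vE Wp Tv dp) par // (om0r hM) ?addr0 //.
by case: vZ => _ TZ _; exact: TZ.
Qed.

(** Pairing with the parallel field [E] replaces each covariant derivative of
    [Z] by a derivative of the function [h = om (Z, E)], and the curvature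
    becomes the commutator of the derivations [X] and [Y] minus the derivation
    [[X, Y]]. *)
Lemma curvature_parallel W E X Y Z p d :
  vfield W E -> vfield W X -> vfield W Y -> vfield W Z ->
  (forall q v, W q -> TM q v -> nabla q v E = 0) ->
  W p -> chart_at p d -> om p (curvature nabla d X Y Z p) (E p) = 0.
Proof.
move=> vE vX vY vZ par Wp dp.
have [ad dpd] := dp.
have [oW TX sX] := vX; have [_ TY sY] := vY; have [_ TE _] := vE.
pose h q := om q (Z q) (E q).
pose U := chart_map d @` (W `&` chart_dom d).
have oU : open U by exact: chart_image_open.
have Uu : U (chart_map d p) by exists p.
have sh : smooth U (h \o chart_inv d : _ -> R^o).
  exact: (form_smooth (symplectic_form (bilag_symplectic hM)) vZ vE ad).
(* Iterated covariant derivatives pair with [E] to iterated derivatives of [h]. *)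
have second (V V' : M -> tvec M) : vfield W V -> vfield W V' ->
    om p (nabla p (V p) (fun q => nabla q (V' q) Z)) (E p) =
    'D_(V p d) (fun u => 'D_(V' (chart_inv d u) d) (h \o chart_inv d : _ -> R^o) u)
      (chart_map d p).
  move=> vV vV'; have [_ TV _] := vV; have [_ TV' _] := vV'.
  rewrite (om_parallel vE (conn_smooth conn vV' vZ) par Wp (TV p Wp) dp).
  rewrite /dirder; apply: near_eq_derive.
  apply: filterS (near_chart dp oW Wp) => _ [q [Wq dq ->]] /=.
  rewrite chart_invK //.
  exact: (om_parallel vE vZ par Wq (TV' q Wq) (conj ad dq)).
have TB := lie_bracket_TM X Y dp.
have TN V V' : vfield W V -> vfield W V' ->
    TM p (nabla p (V p) (fun q => nabla q (V' q) Z)).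
  move=> vV vV'; apply: (conn_tangent conn (conn_smooth conn vV' vZ) Wp).
  by case: vV => _ TV _; exact: TV.
have TNB : TM p (nabla p (lie_bracket d X Y p) Z).
  exact: (conn_tangent conn vZ Wp TB).
have omB v w z : TM p v -> TM p w -> TM p z -> om p (v - w) z = om p v z - om p w z.
  move=> Tv Tw Tz; rewrite -scaleN1r addrC (om_linl hM) // mulN1r.
  by rewrite addrC.
rewrite /curvature !omB //; try (by apply: TE); try (by apply: TN);
  last by apply: TMB; exact: TN.
rewrite !second // (om_parallel vE vZ par Wp TB dp).
rewrite /dirder lie_bracket_chart //.
have := bracket_commutator oU Uu sh (sX d ad) (sY d ad).
rewrite (chart_invK ad dpd) => ->.
by apply/eqP; rewrite subr_eq0.
Qed.

Variables (f g : 'rV[R]_n -> 'M[R]_n) (r : R).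
Hypothesis r0 : 0 < r.
Hypothesis ball_dom : ball 0 r `<=` chart_map c @` chart_dom c.
Hypotheses (sf : smooth (ball 0 r) f) (sg : smooth (ball 0 r) g).
Hypothesis Afg : forall x y, ball 0 r x -> ball 0 r y ->
  mixed_matrix om c x y = f x *m g y.

Let U := chart_dom c `&` chart_map c @^-1` (ball 0 r).
Let oU : open U. Proof. by apply: chart_preimage_open => //; exact: ball_open. Qed.
Let UW : U `<=` chart_dom c. Proof. by move=> p []. Qed.
Let O : set 'rV[R]_(n + n) := ball 0 r.
Let oO : open O. Proof. exact: ball_open. Qed.

Let ball_lr u : O u -> ball 0 r (lsubmx u) /\ ball 0 r (rsubmx u).
Proof. by rewrite -{1}[u]hsubmxK => /ball_row_mx. Qed.

Let fg_unit x y : ball 0 r x -> ball 0 r y -> (f x \in unitmx) && (g y \in unitmx).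
Proof.
move=> xr yr; rewrite -unitmx_mul -Afg //.
have /ball_dom[p cp pE] : ball 0 r (row_mx x y) by apply/ball_row_mx.
have := mixed_unit hM ac hF hG cp.
by rewrite pE /mixed_at row_mxKl row_mxKr.
Qed.

Let f_unit x : ball 0 r x -> f x \in unitmx.
Proof. by move=> xr; have /andP[] := fg_unit xr (ballxx _ r0). Qed.

Let g_unit y : ball 0 r y -> g y \in unitmx.
Proof. by move=> yr; have /andP[] := fg_unit (ballxx _ r0) yr. Qed.

(** Combinations, with constant coefficients [a], of the rows of [f^-1]; and
    similarly for [g] below, transposed because [g] stands on the right in [A =
    f g]. *)
Definition xi_coords (a : 'rV[R]_n) (u : 'rV[R]_(n + n)) : 'rV[R]_n :=
  a *m invmx (f (lsubmx u)).
Definition eta_coords (b : 'rV[R]_n) (u : 'rV[R]_(n + n)) : 'rV[R]_n :=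
  b *m (invmx (g (rsubmx u)))^T.

Definition xi a := field_of c (fun u => row_mx (xi_coords a u) 0 : 'rV[R]_(n + n)).
Definition eta b := field_of c (fun u => row_mx 0 (eta_coords b u) : 'rV[R]_(n + n)).

Let imU : chart_map c @` U `<=` O. Proof. by move=> _ [p [_ Op] <-]. Qed.

Lemma xi_section a : section_of F U (xi a).
Proof.
apply: section_F => // k; apply: kdiff_sub imU _.
apply: kdiff_row_mx => //; last exact: kdiff_cst.
apply: kdiff_mulmx => //; first exact: kdiff_cst.
apply: (kdiff_comp_mx (V := ball 0 r) (phi := lsubmx) (F := fun x => invmx (f x))) => //.
- exact: ball_open.
- by move=> u /ball_lr[].
- exact: kdiff_lsubmx.
- by apply: kdiff_invmx => //; exact: ball_open.
Qed.

Lemma eta_section b : section_of G U (eta b).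
Proof.
apply: section_G => // k; apply: kdiff_sub imU _.
apply: kdiff_row_mx => //; first exact: kdiff_cst.
apply: kdiff_mulmx => //; first exact: kdiff_cst.
apply: (kdiff_comp_mx (V := ball 0 r) (phi := rsubmx) (F := fun x => (invmx (g x))^T)) => //.
- exact: ball_open.
- by move=> u /ball_lr[].
- exact: kdiff_rsubmx.
- have oB : open (ball (0 : 'rV[R]_n) r) by exact: ball_open.
  have kI : kdiff k (ball 0 r) (fun y => invmx (g y)) by exact: kdiff_invmx.
  apply/(kdiff_mxP _ _ oB) => i j; move/(kdiff_mxP _ _ oB): kI => /(_ j i) kI.
  by apply: kdiff_ext kI => // y _; rewrite mxE.
Qed.

Section At.
Variables (p : M) (Up : U p).
Let cp : chart_dom c p := UW Up.
Let cpc : chart_at p c := conj ac cp.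
Let u := chart_map c p.
Let Ou : O u := proj2 Up.

Let Txi a : TM p (xi a p). Proof. exact: TM_tvec_of. Qed.
Let Teta b : TM p (eta b p). Proof. exact: TM_tvec_of. Qed.

Let AE : A u = f (lsubmx u) *m g (rsubmx u).
Proof. by have [ul ur] := ball_lr Ou; rewrite /A /mixed_at Afg. Qed.

Lemma xi_chart a : xi a p c = row_mx (xi_coords a u) 0.
Proof. exact: tvec_of_chart. Qed.

Lemma eta_chart b : eta b p c = row_mx 0 (eta_coords b u).
Proof. exact: tvec_of_chart. Qed.

Lemma om_eta v b : TM p v ->
  om p v (eta b p) = (lsubmx (v c) *m f (lsubmx u) *m b^T) 0 0.
Proof.
move=> Tv; have [ul ur] := ball_lr Ou.
rewrite (om_coords hM ac hF hG cp) // eta_chart row_mxKl row_mxKr !mul0mx.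
rewrite [X in _ - X]mxE subr0 -/u -/A AE /eta_coords trmx_mul trmxK !mulmxA.
by rewrite mulmxK // g_unit.
Qed.

Lemma om_xi v a : TM p v ->
  om p v (xi a p) = - (a *m g (rsubmx u) *m (rsubmx (v c))^T) 0 0.
Proof.
move=> Tv; have [ul ur] := ball_lr Ou.
rewrite (om_coords hM ac hF hG cp) // xi_chart row_mxKl row_mxKr trmx0 mulmx0.
rewrite [X in X - _]mxE sub0r -/u -/A AE /xi_coords !mulmxA.
by rewrite mulmxKV // f_unit.
Qed.

(** The pairings with the frame recover [l f] and [g r^T], where [(l, r)] are
    the components of [v]. *)
Lemma om_frame_inj v : TM p v -> (forall a, om p v (xi a p) = 0) ->
  (forall b, om p v (eta b p) = 0) -> v = 0.
Proof.
move=> Tv vxi veta; have [ul ur] := ball_lr Ou.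
apply: (TM_inj cpc Tv (TM0 p)).
have l0 : lsubmx (v c) = 0.
  have /(congr1 (mulmx^~ (invmx (f (lsubmx u))))) : lsubmx (v c) *m f (lsubmx u) = 0.
    by apply: form_row_inj => b; rewrite -om_eta // veta mul0mx mxE.
  by rewrite mulmxK ?f_unit // mul0mx.
have r0' : rsubmx (v c) = 0.
  have /(congr1 (mulmx (invmx (g (rsubmx u))))) : g (rsubmx u) *m (rsubmx (v c))^T = 0.
    apply: form_col_inj => a; apply: oppr_inj.
    by rewrite mulmxA -om_xi // vxi mulmx0 mxE oppr0.
  by rewrite mulKmx ?g_unit // mulmx0 => /(congr1 trmx); rewrite trmxK trmx0.
by rewrite -[LHS]hsubmxK l0 r0' row_mx0.
Qed.

(** Each field is constant in the direction of the other, as it depends on its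
    own half of the coordinates only. *)
Lemma xi_eta_bracket a b : lie_bracket c (xi a) (eta b) p = 0.
Proof.
rewrite lie_bracket_field //.
rewrite (@derive_along_cst _ _ _ (fun u => row_mx 0 (eta_coords b u))); last first.
  by move=> h; rewrite /eta_coords -[chart_map c p]hsubmxK scale_row_mx scaler0
    add_row_mx add0r !row_mxKr.
rewrite (@derive_along_cst _ _ _ (fun u => row_mx (xi_coords a u) 0)); last first.
  by move=> h; rewrite /xi_coords -[chart_map c p]hsubmxK scale_row_mx scaler0
    add_row_mx add0r !row_mxKl.
by rewrite subrr tvec_of0.
Qed.

Lemma nabla_xi_eta a b :
  nabla p (xi a p) (eta b) = 0 /\ nabla p (eta b p) (xi a) = 0.
Proof.
exact: (nabla_commuting ac hF hG hnabla (xi_section a) (eta_section b) Up cp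
  (xi_eta_bracket a b)).
Qed.

Lemma tangent_frame v : TM p v ->
  exists a b, v = 1 *: xi a p + eta b p.
Proof.
move=> Tv; have [ul ur] := ball_lr Ou.
exists (lsubmx (v c) *m f (lsubmx u)), (rsubmx (v c) *m (g (rsubmx u))^T).
apply: (TM_inj cpc Tv); first exact: TM_lin.
rewrite -[RHS]/(1 *: xi _ p c + eta _ p c) xi_chart eta_chart scale1r.
rewrite add_row_mx addr0 add0r /xi_coords mulmxK ?f_unit // /eta_coords -mulmxA -trmx_mul.
by rewrite mulVmx ?g_unit // trmx1 mulmx1 hsubmxK.
Qed.

End At.

Lemma om_xi_eta p a b : U p -> om p (xi a p) (eta b p) = (a *m b^T) 0 0.
Proof.
move=> Up; have [ul ur] := ball_lr (proj2 Up).
rewrite om_eta // ?xi_chart // ?row_mxKl /xi_coords ?mulmxKV ?f_unit //.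
by apply: TM_tvec_of; split => //; exact: UW.
Qed.

(** This derivative is tangent to [F], so only its pairings with [eta b] have to
    vanish: they are derivatives of the constants [om (xi a) (eta b)]. *)
Lemma nabla_xi_xi p a' a : U p -> nabla p (xi a' p) (xi a) = 0.
Proof.
move=> Up; have cp := UW Up; have cpc : chart_at p c by [].
have [[vxi _] [vxi' _]] := (xi_section a, xi_section a').
have Txi : TM p (xi a' p) by exact: TM_tvec_of.
have /(TfolFE hF _ cp)[TN rN] := bilag_conn_F hnabla (xi_section a) Up Txi.
apply: (om_frame_inj Up) => // b.
  by rewrite om_xi // rN trmx0 mulmx0 mxE oppr0.
have [veta _] := eta_section b.
have := bilag_conn_om hnabla vxi veta Up Txi cpc.
rewrite (proj1 (nabla_xi_eta Up a' b)) (om0r hM) ?addr0; last exact: TM_tvec_of.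
by move=> <-; apply: (dirder_near_cst _ cpc oU Up) => q Uq; exact: om_xi_eta.
Qed.

Lemma nabla_eta_eta p b' b : U p -> nabla p (eta b' p) (eta b) = 0.
Proof.
move=> Up; have cp := UW Up; have cpc : chart_at p c by [].
have [[veta _] [veta' _]] := (eta_section b, eta_section b').
have Teta : TM p (eta b' p) by exact: TM_tvec_of.
have /(TfolGE hG _ cp)[TN lN] := bilag_conn_G hnabla (eta_section b) Up Teta.
apply: (om_frame_inj Up) => // a; last by rewrite om_eta // lN !mul0mx mxE.
have [vxi _] := xi_section a.
have Txi : TM p (xi a p) by exact: TM_tvec_of.
have := bilag_conn_om hnabla vxi veta Up Teta cpc.
rewrite (proj2 (nabla_xi_eta Up a b')) (om0l hM) ?add0r; last exact: TM_tvec_of.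
rewrite (form_antisym (symplectic_form (bilag_symplectic hM)) TN Txi) => <-.
rewrite (dirder_near_cst _ cpc oU Up (a := (a *m b^T) 0 0)) ?oppr0 //.
by move=> q Uq; exact: om_xi_eta.
Qed.

(** At each point every tangent vector is the sum of a value of some [xi a'] and
    of some [eta b']. *)
Lemma xi_parallel p v a : U p -> TM p v -> nabla p v (xi a) = 0.
Proof.
move=> Up Tv; have cpc : chart_at p c by split => //; exact: UW.
have [a' [b' ->]] := tangent_frame Up Tv.
rewrite (conn_linear conn 1 (proj1 (xi_section a)) Up); try exact: TM_tvec_of.
by rewrite nabla_xi_xi // (proj2 (nabla_xi_eta Up a b')) scaler0 addr0.
Qed.

Lemma eta_parallel p v b : U p -> TM p v -> nabla p v (eta b) = 0.
Proof.
move=> Up Tv; have cpc : chart_at p c by split => //; exact: UW.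
have [a' [b' ->]] := tangent_frame Up Tv.
rewrite (conn_linear conn 1 (proj1 (eta_section b)) Up); try exact: TM_tvec_of.
by rewrite nabla_eta_eta // (proj1 (nabla_xi_eta Up a' b)) scaler0 addr0.
Qed.

(** The curvature is orthogonal to a parallel frame that spans the tangent
    space. *)
Lemma flat_of_factorization : flat_on nabla U.
Proof.
move=> W X Y Z p d vX vY vZ Up Wp dp.
have oWU : open (W `&` U) by apply: openI => //; case: vX.
have WU1 : W `&` U `<=` W by move=> q [].
have WU2 : W `&` U `<=` U by move=> q [].
have [vX' vY' vZ'] := And3 (vfield_sub oWU WU1 vX) (vfield_sub oWU WU1 vY) (vfield_sub oWU WU1 vZ).
have [[_ TX _] [_ TY _]] := (vX, vY).
apply: (om_frame_inj Up).
- apply: TMB; first apply: TMB.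
  + exact: (conn_tangent conn (conn_smooth conn vY vZ) Wp (TX p Wp)).
  + exact: (conn_tangent conn (conn_smooth conn vX vZ) Wp (TY p Wp)).
  + exact: (conn_tangent conn vZ Wp (lie_bracket_TM X Y dp)).
- move=> a; apply: (curvature_parallel (W := W `&` U)) => //.
    exact: vfield_sub oWU WU2 (proj1 (xi_section a)).
  by move=> q v [_ Uq] Tv; exact: xi_parallel.
- move=> b; apply: (curvature_parallel (W := W `&` U)) => //.
    exact: vfield_sub oWU WU2 (proj1 (eta_section b)).
  by move=> q v [_ Uq] Tv; exact: eta_parallel.
Qed.

End Backward.

(** * The equivalence *)

Lemma flat_factorization (R : realType) (n : nat) (M : manifold R (n + n))
    (om : M -> tvec M -> tvec M -> R) (F G : foliation M)
    (nabla : M -> tvec M -> (M -> tvec M) -> tvec M)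
    (c : chart R (n + n) M) (p0 : M) (U : set M) :
  bilagrangian om F G -> bilagrangian_connection om F G nabla ->
  chart_at p0 c -> chart_map c p0 = 0 ->
  (forall p, chart_dom c p -> Tfol F p = Tx c p) ->
  (forall p, chart_dom c p -> Tfol G p = Ty c p) ->
  open U -> U p0 -> flat_on nabla U ->
  exists (f g : 'rV[R]_n -> 'M[R]_n) (V : set 'rV[R]_n),
     [/\ open V, V 0, smooth V f, smooth V g &
         \forall x \near (0 : 'rV[R]_n) & y \near (0 : 'rV[R]_n),
           mixed_matrix om c x y = f x *m g y].
Proof.
move=> hM hnabla [ac cp0] c0 hF hG oU Up0 flat.
have : nbhs (0 : 'rV[R]_(n + n)) (chart_map c @` (U `&` chart_dom c)).
  apply: open_nbhs_nbhs; split; first exact: chart_image_open.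
  by rewrite -c0; exists p0.
move=> /nbhs_ballP[r /= r0 rU].
pose A := mixed_at om c; pose O : set 'rV[R]_(n + n) := ball 0 r.
have oO : open O by exact: ball_open.
have sA : smooth O A.
  by move=> k; apply: kdiff_sub (mixed_smooth hM ac k) => u /rU[p [_ cp] <-]; exists p.
have uA u : O u -> A u \in unitmx.
  by move=> /rU[p [_ cp] <-]; exact: (mixed_unit hM ac hF hG cp).
have factor := mixed_eq_factor r0 sA uA _.
have {factor} : forall x y, O (row_mx x y) ->
    A (row_mx x y) = A (row_mx x 0) *m (invmx (A 0) *m A (row_mx 0 y)).
  apply: factor => a b u /rU[p [Up cp] <-].
  exact: (flat_mixed_eq hM ac hF hG hnabla a b flat Up cp).
move=> factor; pose V : set 'rV[R]_n := ball 0 r.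
have oV : open V by exact: ball_open.
have O_l (x : 'rV[R]_n) : V x -> O (row_mx x 0).
  by move=> Vx; apply/ball_row_mx; split => //; exact: ballxx.
have O_r (x : 'rV[R]_n) : V x -> O (row_mx 0 x).
  by move=> Vx; apply/ball_row_mx; split => //; exact: ballxx.
exists (fun x => A (row_mx x 0)), (fun y => invmx (A 0) *m A (row_mx 0 y)), V.
split; first exact: oV; first exact: ballxx.
- move=> k; apply: (kdiff_comp_mx oV oO O_l _ (sA k)).
  by apply: kdiff_row_mx => //; [exact: kdiff_id | exact: kdiff_cst].
- move=> k; apply: kdiff_mulmx => //; first exact: kdiff_cst.
  apply: (kdiff_comp_mx oV oO O_r _ (sA k)).
  by apply: kdiff_row_mx => //; [exact: kdiff_cst | exact: kdiff_id].
- have nV : nbhs (0 : 'rV[R]_n) V by exact: nbhsx_ballx.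
  exists (V, V); first by split.
  move=> [x y] [/= Vx Vy].
  rewrite -factor; last by apply/ball_row_mx.
  by rewrite /A /mixed_at row_mxKl row_mxKr.
Qed.

Unset Implicit Arguments.

Theorem theorem10 (R : realType) (n : nat) (M : manifold R (n + n))
    (om : M -> tvec M -> tvec M -> R) (F G : foliation M)
    (nabla : M -> tvec M -> (M -> tvec M) -> tvec M)
    (c : chart R (n + n) M) (p0 : M)
    (hM : bilagrangian om F G)
    (hnabla : bilagrangian_connection om F G nabla)
    (hc : chart_at p0 c) (hc0 : chart_map c p0 = 0)
    (hF : forall p, chart_dom c p -> Tfol F p = Tx c p)
    (hG : forall p, chart_dom c p -> Tfol G p = Ty c p) :
  (exists U : set M, [/\ open U, U p0 & flat_on nabla U])
  <->
  (exists (f g : 'rV[R]_n -> 'M[R]_n) (V : set 'rV[R]_n),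
     [/\ open V, V 0, smooth V f, smooth V g &
         \forall x \near (0 : 'rV[R]_n) & y \near (0 : 'rV[R]_n),
           mixed_matrix om c x y = f x *m g y]).
Proof.
split=> [[U [oU Up0 flat]]|[f [g [V [oV V0 sf sg]]]]].
  exact: flat_factorization hM hnabla hc hc0 hF hG oU Up0 flat.
move=> [[P Q] [/= nP nQ] PQ]; have [ac cp0] := hc.
have nim : nbhs (0 : 'rV[R]_(n + n)) (chart_map c @` chart_dom c).
  apply: open_nbhs_nbhs; split; first exact: chart_image_openW (chart_dom_open ac) _.
  by rewrite -hc0; exists p0.
have nV : nbhs (0 : 'rV[R]_n) V by exact: open_nbhs_nbhs.
have /nbhs_ballP[r1 /= r10 im1] := nim.
have nVPQ : nbhs (0 : 'rV[R]_n) (V `&` (P `&` Q)).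
  by apply: filterI; [exact: nV | apply: filterI; [exact: nP | exact: nQ]].
have /nbhs_ballP[r2 /= r20 VPQ] := nVPQ.
pose r := Num.min r1 r2; have r0 : 0 < r by rewrite lt_min r10 r20.
have b1 : ball (0 : 'rV[R]_(n + n)) r `<=` chart_map c @` chart_dom c.
  by move=> u ur; apply: im1; apply: le_ball ur; rewrite ge_min lexx.
have b2 : ball (0 : 'rV[R]_n) r `<=` V `&` (P `&` Q).
  by move=> x xr; apply: VPQ; apply: le_ball xr; rewrite ge_min lexx orbT.
have sf' : smooth (ball 0 r) f by move=> k; apply: kdiff_sub (sf k) => x /b2[].
have sg' : smooth (ball 0 r) g by move=> k; apply: kdiff_sub (sg k) => x /b2[].
have Afg x y : ball 0 r x -> ball 0 r y -> mixed_matrix om c x y = f x *m g y.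
  by move=> /b2[_ [Px _]] /b2[_ [_ Qy]]; exact: (PQ (x, y)).
exists (chart_dom c `&` chart_map c @^-1` (ball 0 r)); split.
- by apply: chart_preimage_open => //; exact: ball_open.
- by split => //=; rewrite hc0; exact: ballxx.
exact: (flat_of_factorization hM ac hF hG hnabla r0 b1 sf' sg' Afg).
Qed.
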